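(* Let $f:\Omega\to\mathbb H^3_1$ be a timelike immersion of a domain $\Omega\subset\mathbb R^2$ with positive extrinsic curvature and Gauss map $\nu$, and assume that $\nu$ is an immersion. Then the following are equivalent: (1) $\nu$ is harmonic with respect to the Lorentzian structure induced by the second fundamental form of $f$; (2) $f$ has constant Gaussian curvature.
   Context: Ambient space. On the space $\mathfrak{gl}(2,\mathbb R)$ of real $2\times2$ matrices let $\langle X,Y\rangle=-\tfrac12\operatorname{tr}(X\bar Y)$, where $\bar Y=(\operatorname{tr}Y)\mathrm{Id}-Y$; then $\langle X,X\rangle=-\det X$. Anti-de Sitter 3-space is $\mathbb H^3_1=\{X:\langle X,X\rangle=-1\}=SL(2,\mathbb R)$ with the induced Lorentzian metric (of constant curvature $-1$). On $\mathfrak{sl}(2,\mathbb R)$, $\langle X,Y\rangle=\tfrac12\operatorname{tr}(XY)$; put $\mathbb S^2_1=\{X\in\mathfrak{sl}(2,\mathbb R):\langle X,X\rangle=1\}$. All maps are smooth; a domain is a connected open set. An immersion $f$ is timelike if the induced metric $I$ is Lorentzian. Let $N$ be a unit normal ($\langle N,N\rangle=1$, $N$ orthogonal to $f$ and its first derivatives); the Gauss map is $\nu=f^{-1}N:\Omega\to\mathbb S^2_1$. The second fundamental form $II$ has coefficients $L=\langle f_{xx},N\rangle$, $M=\langle f_{xy},N\rangle$, $\mathcal N=\langle f_{yy},N\rangle$. The Gaussian curvature $K$ is given by $K+1=\det II/\det I$, and $K+1$ is called the extrinsic curvature. If $K+1>0$ then $\det II<0$, so $II$ is a Lorentzian metric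 on $\Omega$; its (local) null coordinates, i.e. coordinates in which $L=\mathcal N=0$, are called asymptotic coordinates. A map $\nu$ from a Lorentz surface to $\mathbb S^2_1$ is harmonic (a critical point of the energy) if and only if $[\nu,\nu_{xy}]=0$ in null coordinates $(x,y)$ of the Lorentz structure. *)

(* Defs.v *)
From HB Require Import structures.
From mathcomp Require Import all_boot all_order all_algebra.
From mathcomp Require Import all_classical all_reals all_analysis.

Set Implicit Arguments.
Unset Strict Implicit.
Unset Printing Implicit Defensive.

Import Order.TTheory GRing.Theory Num.Theory.
Import numFieldNormedType.Exports.

Local Open Scope classical_set_scope.
Local Open Scope ring_scope.

(** * Ambient space *)

Definition mbar (R : realType) (Y : 'M[R]_2) : 'M[R]_2 := (\tr Y)%:M - Y.

Definition ads_form (R : realType) (X Y : 'M[R]_2) : R :=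
  - (2%:R^-1 * \tr (X *m mbar Y)).

Definition AdS3 (R : realType) : set 'M[R]_2 := [set X | ads_form X X = -1].

Definition dS2 (R : realType) : set 'M[R]_2 :=
  [set X | \tr X = 0 /\ ads_form X X = 1].

(** * Smooth maps between normed spaces *)

(* Meant for open U: f is n times differentiable on U and all its iterated
   directional derivatives up to order n are continuous on U. *)
Fixpoint Ck_on (R : realType) (V W : normedModType R) (n : nat)
    (U : set V) (f : V -> W) : Prop :=
  match n with
  | 0 => forall p, U p -> {for p, continuous f}
  | m.+1 => (forall p, U p -> differentiable f p) /\
            (forall v : V, Ck_on m U (fun p => 'D_v f p))
  end.

Definition smooth_on (R : realType) (V W : normedModType R)
    (U : set V) (f : V -> W) : Prop :=
  forall n, Ck_on n U f.

Definition immersion_on (R : realType) (V W : normedModType R)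
    (U : set V) (f : V -> W) : Prop :=
  smooth_on U f /\ (forall p, U p -> injective ('d f p)).

(** * Symmetric bilinear forms on the plane, given by their Gram matrices *)

Definition axis (R : realType) (i : 'I_2) : R * R :=
  if i == 0 then (1, 0) else (0, 1).

Definition partial (R : realType) (W : normedModType R) (i : 'I_2)
    (f : R * R -> W) (p : R * R) : W := 'D_(axis R i) f p.

(* Signature (-,+): the columns of P form a pseudo-orthonormal basis. *)
Definition lorentzian (R : realType) (G : 'M[R]_2) : Prop :=
  exists2 P : 'M[R]_2, P \in unitmx &
    P^T *m G *m P = diag_mx (\row_i (if i == 0 then -1 else 1)).

(** * Surfaces in anti-de Sitter space *)

Section Surfaces.
Variables (R : realType) (Omega : set (R * R)).
Implicit Types (f N nu : R * R -> 'M[R]_2) (p : R * R).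

Definition fundI f p : 'M[R]_2 :=
  \matrix_(i < 2, j < 2) ads_form (partial i f p) (partial j f p).

Definition fundII f N p : 'M[R]_2 :=
  \matrix_(i < 2, j < 2) ads_form (partial j (partial i f) p) (N p).

Definition timelike_immersion f : Prop :=
  [/\ immersion_on Omega f,
      forall p, Omega p -> AdS3 (f p) &
      forall p, Omega p -> lorentzian (fundI f p)].

Definition unit_normal f N : Prop :=
  smooth_on Omega N /\
  forall p, Omega p ->
    [/\ ads_form (N p) (N p) = 1, ads_form (N p) (f p) = 0 &
        forall i, ads_form (N p) (partial i f p) = 0].

Definition gauss_map f N p : 'M[R]_2 := invmx (f p) *m N p.

Definition extrinsic_curvature f N p : R :=
  \det (fundII f N p) / \det (fundI f p).

Definition gaussian_curvature f N p : R := extrinsic_curvature f N p - 1.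

(** * Energy and harmonic maps into [dS2] *)

(* One half of the h-trace of the metric pulled back by nu, times the area
   density of h. In dimension two it only depends on the conformal class
   of h. *)
Definition energy_density (h : R * R -> 'M[R]_2) nu p : R :=
  2%:R^-1 * \tr (invmx (h p) *m fundI nu p) * Num.sqrt `|\det (h p)|.

Definition energy (h : R * R -> 'M[R]_2) (C : set (R * R)) nu : R :=
  \int[(@lebesgue_measure R \x @lebesgue_measure R)%E]_(p in C)
    energy_density h nu p.

(* A variation of nu through maps into dS2, of parameter t in ]-eps, eps[,
   with support in C. *)
Definition dS2_variation nu (C : set (R * R)) (eps : R)
    (F : R * (R * R) -> 'M[R]_2) : Prop :=
  [/\ smooth_on [set z | `|z.1| < eps /\ Omega z.2] F,
      forall t p, `|t| < eps -> Omega p -> dS2 (F (t, p)),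
      forall p, Omega p -> F (0, p) = nu p &
      forall t p, `|t| < eps -> Omega p -> ~ C p -> F (t, p) = nu p].

(* Critical points of the energy under compactly supported variations. *)
Definition harmonic_map (h : R * R -> 'M[R]_2) nu : Prop :=
  forall (C : set (R * R)) (eps : R) (F : R * (R * R) -> 'M[R]_2),
    compact C -> C `<=` Omega -> 0 < eps -> dS2_variation nu C eps F ->
    is_derive (0 : R) (1 : R) (fun t : R => energy h C (fun p => F (t, p))) 0.

End Surfaces.

(* Main.v *)
Require Import Defs.
From mathcomp Require Import all_boot all_order all_algebra.
From mathcomp Require Import ring lra.
From mathcomp Require Import all_classical all_reals all_analysis.
From mathcomp Require Import measurable_realfun.

(**
Write [a = f^-1 df] and [d nu = nu a - s], where [s] is the shape operator
applied to [a], and let [c = sqrt (K + 1)], [d = 1 / c].  For the conformal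
class of the second fundamental form, the energy gradient of [nu] is the pair
[flux0 = c nu a_y - d s_y], [flux1 = d s_x - c nu a_x].  The Maurer-Cartan and
Codazzi equations cancel every derivative in its divergence but those of [c]:
the tension is [l nu + c_x P_y - c_y P_x] with [P = nu a + d^2 s].  The area of
[(P_x, P_y)] is a nonzero multiple of that of [d nu], so, [nu] being an
immersion, the tension is normal to [dS2] exactly where [dc = 0].

For a variation [F_t] of [nu], the energy changes by [- int <F_t - nu, E>] up to
[O(t^2)], [E] being the tension.  If [E = l nu], this is [O(t^2)] because
[<F_t - nu, nu> = - <F_t - nu, F_t - nu> / 2].  Conversely it is enough to test
the variations [(1 + t psi X) nu (1 - t psi X)] with [X^2 = 0] and [psi] a bump
function: their velocities [psi [X, nu]] span the tangent planes of [dS2].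
*)

Import Order.TTheory GRing.Theory Num.Theory.
Import numFieldNormedType.Exports.
Local Open Scope classical_set_scope.
Local Open Scope ring_scope.

Set Implicit Arguments.
Unset Strict Implicit.
Unset Printing Implicit Defensive.

(** * Functions of class Ck *)

Section differentiability.
Context {R : realType} {V W : normedModType R}.
Implicit Types (f g : V -> W) (U : set V) (p v : V).

(** Null coordinates of the second fundamental form are never introduced: in the given coordinates
    the energy density is a quadratic form in the partial derivatives of the map, with coefficients
    that are, up to sign, entries of the second fundamental form over the square root of its
    absolute determinant. Its fluxes have a closed form linear in [c] and [1 / c]; it is this form
    that is differentiated, since the structure equations apply to it directly.

    [F_t - nu] is treated as a matrix-valued function, so the change of energy is exactly a linear
    plus a quadratic term. No derivative passes under an integral: an [O(t^2)] bound gives both the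
    existence and the value of the derivative. The price is that the tension keeps a component along
    [nu].

    The sign of [c] is that of the area form of [a]; areas are kept signed and hence smooth, and
    [c^2 = K + 1] holds either way.

    Nilpotent [X] make the test variations polynomial in [t psi], so that no matrix exponential is
    needed. They still suffice because nilpotent matrices span sl2. *)

Lemma near_eq_differentiable f g p :
  {near p, f =1 g} -> differentiable f p -> differentiable g p.
Proof.
move=> fg df; have fgp : f p = g p by exact: (nbhs_singleton fg).
have gE : g \o shift p = cst (g p) + 'd f p +o_ 0 id.
  apply/eqaddoP => e e0.
  have /eqaddoP/(_ _ e0) := diff_locally df.
  have fg0 : \forall h \near (0 : V), f (h + p) = g (h + p).
    have := fg; rewrite -(add0r p) (near_shift 0) /= subr0.
    by apply: filterS => h; rewrite /= ?subr0.
  by apply: filterS2 fg0 => h /=; rewrite !fctE /= => -> /=; rewrite fgp.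
have [cdf _] := (diff_locallyP _ _).1 df.
have dgE : 'd g p = 'd f p :> (V -> W) by exact: diff_unique gE.
by apply/diff_locallyP; rewrite dgE.
Qed.

Lemma open_near_eq U f g p : open U -> U p -> (forall x, U x -> f x = g x) ->
  {near p, f =1 g}.
Proof. by move=> oU Up fg; apply: filterS (open_nbhs_nbhs (conj oU Up)). Qed.

Lemma derive_eq_on U f g v p : open U -> U p ->
  (forall x, U x -> f x = g x) -> 'D_v f p = 'D_v g p.
Proof. by move=> oU Up fg; apply/near_eq_derive/(open_near_eq oU). Qed.

End differentiability.

Lemma derive_real_dir (R : realType) (g : R -> R) (x v : R) :
  differentiable g x -> 'D_v g x = v * 'D_1 g x.
Proof.
move=> dg; rewrite !deriveE//; have E : 'd g x (v *: (1 : R)) = v *: 'd g x 1 by rewrite linearZ.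
by rewrite -[RHS]E; congr ('d g x _); exact/esym/mulr1.
Qed.

Section Ck.
Context {R : realType} {V : normedModType R}.
Implicit Types (U : set V) (p v : V).

(** On an open set an equality of functions passes to their derivatives. The closure properties
    below use this to replace a derivative by its explicit formula before applying the induction
    hypothesis. *)
Lemma Ck_on_eq (W : normedModType R) n U (f g : V -> W) : open U ->
  (forall x, U x -> f x = g x) -> Ck_on n U f -> Ck_on n U g.
Proof.
move=> oU; elim: n f g => [|n IH] f g fg /=.
  move=> cf p Up; have /near_eq_cvg fgp := open_near_eq oU Up fg.
  by rewrite /prop_for /continuous_at -(fg _ Up); apply: cvg_trans (cf p Up);
     apply: near_eq_cvg; exact: (open_near_eq oU Up).
move=> [df Df]; split=> [p Up|v].
  exact: near_eq_differentiable (open_near_eq oU Up fg) (df p Up).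
by apply: IH (Df v) => x Ux; exact: (derive_eq_on _ oU Ux fg).
Qed.

Lemma Ck_onW (W : normedModType R) n U (f : V -> W) :
  Ck_on n.+1 U f -> Ck_on n U f.
Proof.
elim: n f => [|n IH] f [df Df] /=.
  by move=> p Up; exact/differentiable_continuous/df.
by split=> // v; exact/IH/Df.
Qed.

Lemma Ck_on_derivable (W : normedModType R) n U (f : V -> W) :
  Ck_on n.+1 U f -> forall p v, U p -> derivable f p v.
Proof. by move=> [df _] p v Up; exact/diff_derivable/df. Qed.

Lemma Ck_on_subset (W : normedModType R) n U U' (f : V -> W) : U' `<=` U ->
  Ck_on n U f -> Ck_on n U' f.
Proof.
move=> UU'; elim: n f => [|n IH] f /=; first by move=> cf p /UU'/cf.
by move=> [df Df]; split=> [p /UU'/df//|v]; exact: IH.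
Qed.

Lemma Ck_on_cst (W : normedModType R) n U (w : W) : Ck_on n U (fun=> w).
Proof.
elim: n w => [|n IH] w /=; first by move=> p _; exact: cvg_cst.
split=> [p _|v]; first exact: differentiable_cst.
by rewrite (_ : 'D_v _ = fun=> 0) //; apply/funext => p; exact: derive_cst.
Qed.

Lemma Ck_on_linear (W : normedModType R) n U (L : {linear V -> W}) :
  continuous L -> Ck_on n U L.
Proof.
move=> cL; have dL p : differentiable L p by exact: linear_differentiable.
case: n => [|n] /=; first by move=> p _; exact: cL.
split=> [p _|v]; first exact: dL.
rewrite (_ : 'D_v _ = fun=> L v); first exact: Ck_on_cst.
by apply/funext => p; rewrite deriveE// diff_lin.
Qed.

Lemma Ck_on_add (W : normedModType R) n U (f g : V -> W) : open U ->
  Ck_on n U f -> Ck_on n U g -> Ck_on n U (fun x => f x + g x).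
Proof.
move=> oU; elim: n f g => [|n IH] f g.
  by move=> cf cg p Up; apply: cvgD; [exact: cf|exact: cg].
move=> cf cg; split=> [p Up|v].
  by apply: (@differentiableD _ _ _ f g); [exact: cf.1|exact: cg.1].
apply: (@Ck_on_eq _ _ _ (fun x => 'D_v f x + 'D_v g x)) => // [x Ux|].
  by rewrite -deriveD//; [apply: Ck_on_derivable cf _ _ _|
                          apply: Ck_on_derivable cg _ _ _].
by apply: IH; [exact: cf.2|exact: cg.2].
Qed.

Lemma Ck_on_mul n U (f g : V -> R) : open U ->
  Ck_on n U f -> Ck_on n U g -> Ck_on n U (fun x => f x * g x).
Proof.
move=> oU; elim: n f g => [|n IH] f g.
  by move=> cf cg p Up; apply: cvgM; [exact: cf|exact: cg].
move=> cf cg; split=> [p Up|v].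
  by apply: differentiableM; [exact: cf.1|exact: cg.1].
apply: (@Ck_on_eq _ _ _ (fun x => f x * 'D_v g x + g x * 'D_v f x)) => //.
  move=> x Ux; rewrite deriveM//.
    exact: Ck_on_derivable cf _ _ _.
  exact: Ck_on_derivable cg _ _ _.
by apply: Ck_on_add => //; apply: IH; rewrite ?(cf.2, cg.2)//;
  [exact: Ck_onW|exact: cg.2|exact: Ck_onW|exact: cf.2].
Qed.

Lemma Ck_on_opp n U (f : V -> R) : open U -> Ck_on n U f ->
  Ck_on n U (fun x => - f x).
Proof.
move=> oU cf; apply: (@Ck_on_eq _ _ _ (fun x => -1 * f x)) => //.
  by move=> x _; rewrite mulN1r.
by apply: Ck_on_mul => //; exact: Ck_on_cst.
Qed.

Lemma Ck_on_sub n U (f g : V -> R) : open U -> Ck_on n U f -> Ck_on n U g ->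
  Ck_on n U (fun x => f x - g x).
Proof. by move=> oU cf cg; apply: Ck_on_add => //; exact: Ck_on_opp. Qed.

(** With a real outer variable the chain rule is a product of two scalar functions, so the induction
    reduces to [Ck_on_mul]. It serves the bump function and the inverse square root of the area. *)
Lemma Ck_on_comp n U (T : set R) (g : R -> R) (f : V -> R) : open U -> open T ->
  (forall x, U x -> T (f x)) -> Ck_on n T g -> Ck_on n U f ->
  Ck_on n U (g \o f).
Proof.
move=> oU oT fT; elim: n g => [|n IH] g.
  move=> cg cf p Up; apply: continuous_comp; first exact: cf.
  exact/cg/fT.
move=> cg cf; split=> [p Up|v].
  by apply: differentiable_comp; [exact: cf.1|exact/cg.1/fT].
apply: (@Ck_on_eq _ _ _ (fun x => ('D_1 g \o f) x * 'D_v f x)) => //.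
  move=> x Ux /=.
  have dg := cg.1 _ (fT _ Ux); have df := cf.1 _ Ux.
  rewrite !deriveE//; last exact: differentiable_comp.
  rewrite (diff_comp df dg)/=; have := derive_real_dir ('d f x v) dg.
  by rewrite !deriveE// mulrC => ->.
apply: Ck_on_mul => //; last exact: cf.2.
by apply: IH; [exact: cg.2|exact: Ck_onW].
Qed.

End Ck.

Section Ck_matrix.
Context {R : realType} {V : normedModType R} {m1 m2 : nat}.
Implicit Types (U : set V) (F : V -> 'M[R]_(m1.+1, m2.+1)).

Lemma differentiable_entry F p i j : differentiable F p ->
  differentiable (fun x => F x i j) p.
Proof.
move=> dF; apply: (@differentiable_comp _ _ _ _ F (fun M => M i j)) => //.
exact: differentiable_coord.
Qed.

Lemma derive_entry F p v i j : derivable F p v ->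
  ('D_v F p) i j = 'D_v (fun x => F x i j) p.
Proof. by move=> /derive_mx ->; rewrite mxE. Qed.

Lemma differentiable_mxP F p :
  (forall i j, differentiable (fun x => F x i j) p) -> differentiable F p.
Proof.
move=> dF; rewrite (_ : F = \sum_i \sum_j (fun x => F x i j *: delta_mx i j)).
  by do 2!apply: differentiable_sum => ?; exact/differentiableZl/dF.
apply/funext => x; rewrite [LHS]matrix_sum_delta fct_sumE.
by apply: eq_bigr => i _; rewrite fct_sumE.
Qed.

Lemma Ck_on_mxP n U F : open U ->
  (forall i j, Ck_on n U (fun x => F x i j)) <-> Ck_on n U F.
Proof.
move=> oU; elim: n F => [|n IH] F.
  split=> cF.
    move=> p Up; rewrite /prop_for /continuous_at.
    apply/cvgrPdist_lt => e e0; near=> x.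
    rewrite /Num.Def.normr/= mx_normrE; apply/bigmax_ltP; split => //= -[i j] _.
    rewrite !mxE/=; move: (i) (j); near: x.
    apply: filter_forall => i'; apply: filter_forall => j'.
    by have /cvgrPdist_lt/(_ _ e0) := cF i' j' p Up.
  move=> i j p Up; apply: (@continuous_comp _ _ _ F (fun M => M i j)).
    exact: cF.
  exact: coord_continuous.
split=> [cF|cF i j].
  have dF p : U p -> differentiable F p.
    by move=> Up; apply: differentiable_mxP => i j; exact: (cF i j).1.
  split=> [|v]; first exact: dF.
  apply/IH => i j; apply: Ck_on_eq ((cF i j).2 v) => // x Ux.
  by rewrite derive_entry//; exact/diff_derivable/dF.
split=> [p Up|v]; first exact/differentiable_entry/cF.1.
have /IH/(_ i j) := cF.2 v; apply: Ck_on_eq => // x Ux.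
by rewrite derive_entry//; exact/diff_derivable/cF.1.
Unshelve. all: by end_near. Qed.

End Ck_matrix.

Section affine_comp.
Context {R : realType} {V' V W : normedModType R}.
Variables (g : V' -> V) (L : V' -> V).
Hypothesis gL : forall (h : R) v x, g (h *: v + x) = h *: L v + g x.

(** Both sides are limits of the same difference quotient, so the equality is unconditional. *)
Lemma derive_affine_comp (f : V -> W) v x :
  'D_v (f \o g) x = 'D_(L v) f (g x).
Proof.
by rewrite /derive; under eq_fun do rewrite /= gL.
Qed.

Hypothesis dg : forall x, differentiable g x.

Lemma Ck_on_affine_comp n (U : set V') (S : set V) (f : V -> W) :
  (forall x, U x -> S (g x)) -> Ck_on n S f -> Ck_on n U (f \o g).
Proof.
move=> US; elim: n f => [|n IH] f.
  move=> cf x Ux; apply: continuous_comp; last exact/cf/US.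
  exact: differentiable_continuous.
move=> cf; split=> [x Ux|v]; first exact/differentiable_comp/cf.1/US.
rewrite (_ : 'D_v _ = 'D_(L v) f \o g); first exact/IH/cf.2.
by apply/funext => x; rewrite derive_affine_comp.
Qed.

End affine_comp.

Section slices.
Context {R : realType} {V1 V2 W : normedModType R}.

Let slice2L (t : V1) (h : R) (v x : V2) :
  (t, h *: v + x) = h *: (0, v) + (t, x) :> V1 * V2.
Proof. by congr (_, _); rewrite /= ?scaler0 ?add0r. Qed.

Let slice1L (y : V2) (h : R) (v x : V1) :
  (h *: v + x, y) = h *: (v, 0) + (x, y) :> V1 * V2.
Proof. by congr (_, _); rewrite /= ?scaler0 ?add0r. Qed.

Lemma derive_slice2 (f : V1 * V2 -> W) (t : V1) v x :
  'D_v (fun y => f (t, y)) x = 'D_(0, v) f (t, x).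
Proof. exact: (derive_affine_comp (slice2L t)). Qed.

Lemma derive_slice1 (f : V1 * V2 -> W) (y : V2) v x :
  'D_v (fun t => f (t, y)) x = 'D_(v, 0) f (x, y).
Proof. exact: (derive_affine_comp (slice1L y)). Qed.

Lemma Ck_on_slice2 n (S : set (V1 * V2)) (U : set V2) (f : V1 * V2 -> W) t :
  (forall x, U x -> S (t, x)) -> Ck_on n S f -> Ck_on n U (fun x => f (t, x)).
Proof.
apply: (Ck_on_affine_comp (slice2L t)) => x; exact: differentiable_pair.
Qed.

Lemma Ck_on_slice1 n (S : set (V1 * V2)) (U : set V1) (f : V1 * V2 -> W) y :
  (forall x, U x -> S (x, y)) -> Ck_on n S f -> Ck_on n U (fun x => f (x, y)).
Proof.
apply: (Ck_on_affine_comp (slice1L y)) => x; exact: differentiable_pair.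
Qed.

Lemma Ck_on_snd n (S : set (V1 * V2)) (U : set V2) (f : V2 -> W) :
  (forall z, S z -> U z.2) -> Ck_on n U f -> Ck_on n S (fun z => f z.2).
Proof.
apply: (@Ck_on_affine_comp _ _ _ _ snd snd) => // x.
by apply: linear_differentiable => y; exact: cvg_snd.
Qed.

End slices.

(** * Mean values along lines, symmetry of second derivatives, functions with zero derivative *)

Section directional_mean_value.
Context {R : realType} {V : normedModType R}.
Implicit Types (u : V -> R) (U : set V) (p v w : V).

Lemma derive_translate u w v p :
  'D_v (fun q => u (q + w)) p = 'D_v u (p + w).
Proof.
have gL (h : R) x y : h *: x + y + w = h *: x + (y + w) by rewrite addrA.
exact: (derive_affine_comp gL).
Qed.

Lemma line_is_derive u p v s : differentiable u (p + s *: v) ->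
  is_derive s 1 (fun t => u (p + t *: v)) ('D_v u (p + s *: v)).
Proof.
have gL (h x y : R) : p + (h *: x + y) *: v = h *: (x *: v) + (p + y *: v).
  by rewrite scalerDl addrCA scalerA.
move=> du; split; last by rewrite (derive_affine_comp gL) scale1r.
by apply/derivable1_diffP/differentiable_comp.
Qed.

Lemma directional_MVT u p v (h : R) : 0 < h ->
  (forall s, 0 <= s <= h -> differentiable u (p + s *: v)) ->
  exists2 c, 0 < c < h & u (p + h *: v) - u p = h * 'D_v u (p + c *: v).
Proof.
move=> h0 du.
have [||c ch] := @MVT _ (fun t => u (p + t *: v))
  (fun t => 'D_v u (p + t *: v)) 0 h h0.
- move=> s; rewrite in_itv/= => /andP[s0 sh]; apply: line_is_derive.
  by apply: du; rewrite !ltW.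
- apply: derivable_within_continuous => s; rewrite in_itv/= => sh.
  by have [] := line_is_derive (du s sh).
rewrite scale0r addr0 subr0 mulrC => E; by exists c.
Qed.

(** Schwarz's argument: the second difference of [u] over a small parallelogram with sides [h *: v]
    and [h *: w] is [h ^ 2] times a value of either mixed derivative, taken at two points of the
    parallelogram. Were the mixed derivatives different at [p], continuity would keep these two
    values apart. *)
Lemma derive_symmetric u U p v w : open U -> Ck_on 2 U u -> U p ->
  'D_w ('D_v u) p = 'D_v ('D_w u) p.
Proof.
move=> oU cu Up; pose d1 : V -> R := 'D_w ('D_v u); pose d2 : V -> R := 'D_v ('D_w u).
rewrite -[LHS]/(d1 p) -[RHS]/(d2 p).
have Upn : \forall q \near p, U q by exact: (open_nbhs_nbhs (conj oU Up)).
apply/eqP; apply: contraT => ne; pose e := `|d1 p - d2 p| / 2.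
have e0 : 0 < e by rewrite divr_gt0// normr_gt0 subr_eq0.
have near1 : \forall q \near p, `|d1 p - d1 q| < e.
  by have /cvgrPdist_lt/(_ _ e0) := (cu.2 v).2 w p Up.
have near2 : \forall q \near p, `|d2 p - d2 q| < e.
  by have /cvgrPdist_lt/(_ _ e0) := (cu.2 w).2 v p Up.
have near3 : \forall q \near p,
    [/\ U q, `|d1 p - d1 q| < e & `|d2 p - d2 q| < e].
  by apply: filterS3 Upn near1 near2 => q; split.
(* Continuity of the parametrised parallelogram at the origin gives a box of parameters on which all
   estimates hold; [h] is chosen to fit in it. *)
have cpt : (p + z.1 *: v + z.2 *: w) @[z --> ((0, 0) : R * R)] --> p.
  rewrite -[X in _ --> X](_ : p + (0 : R) *: v + (0 : R) *: w = _).
    by apply: cvgD; [apply: cvgD; [exact: cvg_cst|]|];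
      apply: cvgZr_tmp; [exact: cvg_fst|exact: cvg_snd].
  by rewrite !scale0r !addr0.
have [[A B] /= [[a /= a0 aA] [b /= b0 bB]] AB] := cpt _ near3.
pose h := Num.min a b / 2.
have h0 : 0 < h by rewrite divr_gt0// lt_min a0.
have [ha hb] : h < a /\ h < b.
  by apply/andP; rewrite -lt_min gtr_pMr ?invf_lt1 ?ltr1n// lt_min a0.
have near4 s t : 0 <= s <= h -> 0 <= t <= h ->
    [/\ U (p + s *: v + t *: w), `|d1 p - d1 (p + s *: v + t *: w)| < e &
        `|d2 p - d2 (p + s *: v + t *: w)| < e].
  move=> /andP[s0 sh] /andP[t0 th]; apply: (AB (s, t)).
  split; [apply: aA|apply: bB]; rewrite /= sub0r normrN ger0_norm//.
    exact: le_lt_trans ha.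
  exact: le_lt_trans hb.
have itv0 : 0 <= (0 : R) <= h by rewrite lexx ltW.
have itvh : 0 <= h <= h by rewrite lexx ltW.
have du s t : 0 <= s <= h -> 0 <= t <= h -> differentiable u (p + s *: v + t *: w).
  by move=> sh th; apply: cu.1; have [] := near4 s t sh th.
have dDu x s t : 0 <= s <= h -> 0 <= t <= h ->
    differentiable ('D_x u) (p + s *: v + t *: w).
  by move=> sh th; apply: (cu.2 x).1; have [] := near4 s t sh th.
pose D := u (p + h *: v + h *: w) - u (p + h *: v) - (u (p + h *: w) - u p).
have shiftE x y z : p + x *: y + z = (p + z) + x *: y by rewrite addrAC.
have [q1 [Uq1 dq1 _] Dq1] : exists2 q,
    [/\ U q, `|d1 p - d1 q| < e & `|d2 p - d2 q| < e] & D = h * (h * d1 q).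
  pose psi q := u (q + h *: w) - u q.
  have dsh q : differentiable u (q + h *: w) ->
      differentiable (fun q => u (q + h *: w)) q.
    move=> duq; apply: (@differentiable_comp _ _ _ _ (fun q => q + h *: w)); last exact: duq.
    by [].
  have [s sh|c ch Ec] := directional_MVT (u := psi) (p := p) (v := v) h0.
    apply: differentiableB; first exact/dsh/du.
    by have := du s 0 sh itv0; rewrite scale0r addr0.
  have {}ch : 0 <= c <= h by case/andP: ch => ? ?; rewrite !ltW.
  have [t th|c' ch' Ec'] := directional_MVT (u := 'D_v u) (p := p + c *: v) (v := w) h0.
    exact: dDu.
  have {}ch' : 0 <= c' <= h by case/andP: ch' => ? ?; rewrite !ltW.
  exists (p + c *: v + c' *: w); first exact: near4.
  rewrite -Ec' /D -[LHS]/(psi _ - psi _) Ec; congr (_ * _).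
  have dpc : differentiable u (p + c *: v).
    by have := du c 0 ch itv0; rewrite scale0r addr0.
  rewrite /psi deriveB; last 2 first.
  - exact/diff_derivable/dsh/du.
  - exact: diff_derivable.
  by rewrite derive_translate.
have [q2 [Uq2 _ dq2] Dq2] : exists2 q,
    [/\ U q, `|d1 p - d1 q| < e & `|d2 p - d2 q| < e] & D = h * (h * d2 q).
  pose psi q := u (q + h *: v) - u q.
  have dsh q : differentiable u (q + h *: v) ->
      differentiable (fun q => u (q + h *: v)) q.
    move=> duq; apply: (@differentiable_comp _ _ _ _ (fun q => q + h *: v)); last exact: duq.
    by [].
  have [s sh|c ch Ec] := directional_MVT (u := psi) (p := p) (v := w) h0.
    apply: differentiableB; first by apply: dsh; rewrite addrAC; exact: du.
    by have := du 0 s itv0 sh; rewrite scale0r addr0.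
  have {}ch : 0 <= c <= h by case/andP: ch => ? ?; rewrite !ltW.
  have [t th|c' ch' Ec'] := directional_MVT (u := 'D_w u) (p := p + c *: w) (v := v) h0.
    by rewrite addrAC; exact: dDu.
  have {}ch' : 0 <= c' <= h by case/andP: ch' => ? ?; rewrite !ltW.
  exists (p + c *: w + c' *: v); first by rewrite addrAC; exact: near4.
  rewrite -Ec' [LHS](_ : _ = psi (p + h *: w) - psi p); last first.
    by rewrite /D /psi (addrAC p (h *: w)); ring.
  rewrite Ec; congr (_ * _).
  have dpc : differentiable u (p + c *: w).
    by have := du 0 c itv0 ch; rewrite scale0r addr0.
  rewrite /psi deriveB; last 2 first.
  - by apply/diff_derivable/dsh; rewrite addrAC; exact: du.
  - exact: diff_derivable.
  by rewrite derive_translate.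
have d12 : d1 q1 = d2 q2.
  have : h * (h * d1 q1) = h * (h * d2 q2) by rewrite -Dq1 -Dq2.
  by move=> /(mulfI (lt0r_neq0 h0)); exact: (mulfI (lt0r_neq0 h0)).
have dist2 (x y z : R) : `|x - z| < e -> `|y - z| < e -> `|x - y| < e + e.
  by rewrite (distrC y) => xz zy; rewrite -(subrKA z) (le_lt_trans (ler_normD _ _)) ?ltrD.
by rewrite d12 in dq1; have := dist2 _ _ _ dq1 dq2; rewrite -splitr ltxx.
Qed.

Lemma derive0_locally_constant u U p : open U -> U p ->
  (forall q v, U q -> differentiable u q /\ 'D_v u q = 0) ->
  \forall q \near p, u q = u p.
Proof.
move=> oU Up du; have /nbhs_ballP[r /= r0 rU] : nbhs p U by exact: (open_nbhs_nbhs (conj oU Up)).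
apply/nbhs_ballP; exists r => //= q pq.
have inU s : 0 <= s <= 1 -> U (p + s *: (q - p)).
  move=> /andP[s0 s1]; apply: rU; move: pq; rewrite -!ball_normE /ball_/=.
  rewrite opprD addNKr normrN normrZ (ger0_norm s0) distrC => /(le_lt_trans _); apply.
  by rewrite ler_piMl.
have [s|c /andP[c0 c1]] := directional_MVT (u := u) (p := p) (v := q - p) ltr01.
  by move=> /inU/(du _ 0)[].
have /inU/(du _ (q - p))[_ ->] : 0 <= c <= 1 by rewrite !ltW.
by rewrite mulr0 scale1r [p + _]addrC subrK => /eqP; rewrite subr_eq0 => /eqP.
Qed.

(** By local constancy, both the set where [u] takes the value [u p] and the set where it does not
    are open in [U]. *)
Lemma derive0_constant u U : open U -> connected U ->
  (forall q v, U q -> differentiable u q /\ 'D_v u q = 0) ->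
  forall p q, U p -> U q -> u p = u q.
Proof.
move=> oU cU du p q Up Uq.
have lc := derive0_locally_constant oU _ du.
pose B := U `&` [set x | u x = u p].
have BU : B = U.
  apply: cU.
  - by exists p.
  - exists B; last by rewrite setIA setIid.
    rewrite openE => x [Ux ux]; have := lc x Ux.
    by apply: filterS2 (open_nbhs_nbhs (conj oU Ux)) => y Uy /=; rewrite ux.
  - exists (~` (U `&` [set x | u x <> u p])).
      rewrite closedC openE => x [Ux ux]; have := lc x Ux.
      by apply: filterS2 (open_nbhs_nbhs (conj oU Ux)) => y Uy /= uyx; split => //=; rewrite uyx.
    rewrite /B; apply/seteqP; split=> x [Ux /= ux]; split => //=.
      by move=> [_].
    by apply: contrapT => ne; apply: ux.
by move: Uq; rewrite -BU => -[_].
Qed.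

End directional_mean_value.

(** * Integration over compact plane sets *)

Section plane_integration.
Context {R : realType}.
Notation mu := (@lebesgue_measure R).
Notation mu2 := (mu \x mu)%E.
Implicit Types (C Omega : set (R * R)).

(** The plane carries the product sigma-algebra, so an open set has to be exhibited as a countable
    union of boxes, here with rational end points. *)
Lemma open_measurable2 (A : set (R * R)) : open A -> measurable A.
Proof.
move=> oA.
pose box (q : rat * rat * (rat * rat)) : set (R * R) :=
  `]ratr q.1.1, ratr q.1.2[ `*` `]ratr q.2.1, ratr q.2.2[.
(* A box that leaves [A] contributes the empty set, so that the union runs over the whole countable
   type of rational quadruples. *)
pose F q : set (R * R) := if `[< box q `<=` A >] then box q else set0.
have -> : A = \bigcup_q F q.
  apply/seteqP; split=> [[x y] Axy|x [q _]]; last first.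
    by rewrite /F; case: asboolP => // qA; exact: qA.
  have : nbhs (x, y) A by exact: (open_nbhs_nbhs (conj oA Axy)).
  move=> [[B1 B2] /= [[r1 /= r10 rB1] [r2 /= r20 rB2]] B12].
  have rat2 (z r : R) : 0 < r -> exists a b : rat,
      ratr a < z < ratr b /\ (forall t, ratr a < t < ratr b -> `|z - t| < r).
    move=> r0.
    have [|a az] := @rat_in_itvoo R (z - r) z; first by rewrite ltrBlDr ltrDl.
    have [|b zb] := @rat_in_itvoo R z (z + r); first by rewrite ltrDl.
    exists a, b; move: az zb; rewrite !in_itv/= => /andP[? az] /andP[zb ?].
    split; first by rewrite az.
    by move=> t; rewrite ltr_distlC => /andP[? ?]; apply/andP; split; lra.
  have [a1 [b1 [xab1 ab1]]] := rat2 x _ r10.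
  have [a2 [b2 [yab2 ab2]]] := rat2 y _ r20.
  exists ((a1, b1), (a2, b2)) => //; rewrite /F; case: asboolP => [_ //|[]].
  move=> [s t] [/= /ab1 s1 /ab2 t2]; apply: (B12 (s, t)).
  by split; [exact: rB1|exact: rB2].
rewrite /F; apply: countable_bigcupT_measurable => [|q].
  exact: countableP.
case: ifP => // _; apply: measurableX; exact: measurable_itv.
Qed.

Lemma closed_measurable2 (A : set (R * R)) : closed A -> measurable A.
Proof. by move/closed_openC/open_measurable2/measurableC; rewrite setCK. Qed.

Lemma compact_measurable2 C : compact C -> measurable C.
Proof.
by move=> cC; apply: closed_measurable2; exact: compact_closed.
Qed.

Lemma compact_sub_square C : compact C ->
  exists2 M : R, 0 < M & forall p, C p -> `|p.1| < M /\ `|p.2| < M.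
Proof.
move=> /compact_bounded[M [_ MC]]; exists (`|M| + 1); first by rewrite ltr_wpDl.
move=> p Cp; have M2 : M < `|M| + 1 / 2 by rewrite (le_lt_trans (ler_norm _))// ltrDl.
have := MC _ M2 p Cp; rewrite /= prod_normE/= ge_max => /andP[p1 p2].
have M1 : `|M| + 1 / 2 < `|M| + 1 by rewrite ltrD2l; lra.
by split; exact: le_lt_trans M1.
Qed.

Lemma compact_finite_measure2 C : compact C -> (mu2 C < +oo)%E.
Proof.
move=> cC; have [M M0 MC] := compact_sub_square cC.
have CM : C `<=` `[-M, M] `*` `[-M, M].
  by move=> p /MC[p1 p2]; split; rewrite /= in_itv/= -ler_norml ltW.
apply: (@le_lt_trans _ _ (mu2 (`[-M, M] `*` `[-M, M]))).
  apply: le_measure => //; rewrite inE; first exact: compact_measurable2.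
  by apply: measurableX; exact: measurable_itv.
rewrite product_measure1E; try exact: measurable_itv.
have muM : (mu [set` `[-M, M]%R] < +oo)%E.
  by rewrite lebesgue_measure_itv/=; case: ifP => _; rewrite -?EFinB ltry.
by apply: lte_mul_pinfty => //; rewrite ge0_fin_numE.
Qed.

Lemma continuous_integrable2 C Omega (u : R * R -> R) : open Omega ->
  compact C -> C `<=` Omega -> (forall p, Omega p -> {for p, continuous u}) ->
  mu2.-integrable C (EFin \o u).
Proof.
move=> oO cC CO cu; have mC := compact_measurable2 cC.
apply: measurable_bounded_integrable => //.
- exact: compact_finite_measure2.
- apply: (measurability _ (RGenOpens.measurableE R)).
  move=> _ [_ [a [b ->] <-]].
  (* The function is known to be continuous only on [Omega], so the preimage becomes open after
     intersection with [Omega]. *)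
  rewrite (_ : C `&` _ = C `&` (Omega `&` u @^-1` `]a, b[%classic)); last first.
    by apply/seteqP; split=> p [Cp]; [split => //; split => //; exact: CO|case].
  apply: measurableI => //; apply: open_measurable2.
  rewrite openE => p [Op up].
  apply: filterI; first exact: (open_nbhs_nbhs (conj oO Op)).
  by apply: (cu p Op); apply: open_nbhs_nbhs; split => //; exact: interval_open.
- have [|M [_ Mu]] := @compact_bounded _ _ (u @` C).
    apply: continuous_compact => //; apply: continuous_in_subspaceT => p.
    by rewrite inE => /CO/cu.
  by exists M; split; rewrite ?num_real// => x Mx p Cp; apply: Mu => //; exists p.
Qed.

Lemma integral_derive_eq0 (h : R -> R) (M : R) : 0 < M ->
  (forall t, derivable h t 1) -> continuous ('D_1 h) ->
  (forall t, M <= `|t| -> h t = 0 /\ 'D_1 h t = 0) ->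
  (\int[mu]_t ('D_1 h t)%:E = 0)%E.
Proof.
move=> M0 dh cDh hM.
have -> : (\int[mu]_t ('D_1 h t)%:E = \int[mu]_(t in `[(- M)%R, M]) ('D_1 h t)%:E)%E.
  rewrite [RHS]integral_mkcond; apply: eq_integral => t _; rewrite patchE.
  case: ifPn => //; rewrite notin_setE/= in_itv/= => /negP.
  by rewrite -ler_norml -ltNge => /ltW/hM[_ ->].
have ch : continuous h.
  by move=> t; apply: differentiable_continuous; exact/derivable1_diffP.
rewrite (@continuous_FTC2 _ _ h).
- have [hMM _] : h M = 0 /\ 'D_1 h M = 0 by apply: hM; rewrite ger0_norm// ltW.
  have [hNM _] : h (- M) = 0 /\ 'D_1 h (- M) = 0.
    by apply: hM; rewrite normrN ger0_norm// ltW.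
  by rewrite hMM hNM subee.
- lra.
- exact: continuous_subspaceT.
- split; first by move=> t _; exact: dh.
  + by apply: cvg_at_right_filter; exact: ch.
  + by apply: cvg_at_left_filter; exact: ch.
- by move=> t _; rewrite derive1E.
Qed.

(** Extended by zero, [Y] is C1 on the whole plane, because [Omega] and the complement of [C] are
    open and cover it. Fubini and the fundamental theorem of calculus on each line in direction [i]
    then give zero. *)
Lemma Rintegral_partial_eq0 C Omega (Y : R * R -> R) (i : 'I_2) :
  open Omega -> compact C -> C `<=` Omega -> Ck_on 1 Omega Y ->
  (forall p, Omega p -> ~ C p -> Y p = 0) ->
  \int[mu2]_(p in C) partial i Y p = 0.
Proof.
move=> oO cC CO cY Y0; set v := axis R i; pose Z := Y \_ C.
have oC : open (~` C).
  by apply: closed_openC; apply: compact_closed => //; exact: norm_hausdorff.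
have ZO p : Omega p -> Y p = Z p.
  move=> Op; rewrite /Z patchE; case: ifPn => //.
  by rewrite notin_setE => /(Y0 _ Op).
have ZC p : (~` C) p -> 0 = Z p.
  by move=> nCp; rewrite /Z patchE memNset.
have cZ : Ck_on 1 setT Z.
  have cZO : Ck_on 1 Omega Z := Ck_on_eq oO ZO cY.
  have cZC : Ck_on 1 (~` C) Z := Ck_on_eq oC ZC (Ck_on_cst _ _ 0).
  split=> [p _|w p _]; have [Cp|nCp] := pselect (C p).
  - exact/cZO.1/CO.
  - exact: cZC.1.
  - exact/(cZO.2 w)/CO.
  - exact: (cZC.2 w).
have DZ0 p w : ~ C p -> 'D_w Z p = 0.
  by move=> nCp; rewrite -(derive_eq_on w oC nCp ZC) derive_cst.
have [M M0 MC] := compact_sub_square cC.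
have Z0 x y : M <= `|x| \/ M <= `|y| -> ~ C (x, y).
  by move=> xy /MC/=[x0 y0]; case: xy; rewrite leNgt ?x0 ?y0.
have iZ : mu2.-integrable setT (EFin \o 'D_v Z).
  have iC : mu2.-integrable C (EFin \o 'D_v Z).
    exact: (continuous_integrable2 openT cC (@subsetT _ _) (cZ.2 v)).
  have := (@integrable_mkcond _ _ _ mu2 C (EFin \o 'D_v Z)
    (compact_measurable2 cC)).1 iC.
  rewrite (_ : _ \_ C = EFin \o 'D_v Z) //; apply/funext => p.
  rewrite patchE; case: ifPn => //; rewrite notin_setE => nCp.
  by rewrite /= DZ0.
(* The derivative of [Z] vanishes off [C], so the integral over [C] is one over the plane, to which
   Fubini applies. *)
rewrite /Rintegral [X in fine X](_ : _ = \int[mu2]_p ('D_v Z p)%:E)%E; last first.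
  rewrite integral_mkcond; apply: eq_integral => p _; rewrite patchE.
  case: ifPn; last by rewrite notin_setE => nCp; rewrite DZ0.
  by rewrite inE => Cp; rewrite /partial (derive_eq_on _ oO (CO _ Cp) ZO).
have cl1 (y : R) : continuous (fun x : R => 'D_v Z (x, y)).
  move=> x; apply: (@continuous_comp _ _ _ (fun x : R => (x, y)) ('D_v Z)); last exact: (cZ.2 v).
  exact/differentiable_continuous/differentiable_pair.
have cl2 (x : R) : continuous (fun y : R => 'D_v Z (x, y)).
  move=> y; apply: (@continuous_comp _ _ _ (fun y : R => (x, y)) ('D_v Z)); last exact: (cZ.2 v).
  exact/differentiable_continuous/differentiable_pair.
rewrite /v/axis in iZ cl1 cl2 *; case: ifPn iZ cl1 cl2 => _ iZ cl1 cl2.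
  rewrite -(integral21_prod_meas1 iZ) [X in fine X](_ : _ = 0%E)//.
  apply: integral0_eq => y _; rewrite /fubini_G.
  have E : (fun x => 'D_(1, 0) Z (x, y)) = 'D_1 (fun x => Z (x, y)).
    by apply/funext => x; rewrite derive_slice1.
  transitivity (\int[mu]_x ('D_1 (fun x => Z (x, y)) x)%:E)%E;
    last apply: (@integral_derive_eq0 (fun x => Z (x, y)) M M0).
  - by apply: eq_integral => x _; rewrite derive_slice1.
  - move=> x; apply: (@Ck_on_derivable _ _ _ 0 setT) => //.
    exact: (@Ck_on_slice1 _ _ _ _ _ setT).
  - by have := cl1 y; rewrite E.
  - move=> x Mx; have nC : ~ C (x, y) by apply: Z0; left.
    by rewrite derive_slice1 DZ0// -ZC.
rewrite -(integral12_prod_meas1 iZ) [X in fine X](_ : _ = 0%E)//.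
apply: integral0_eq => x _; rewrite /fubini_F.
have E : (fun y => 'D_(0, 1) Z (x, y)) = 'D_1 (fun y => Z (x, y)).
  by apply/funext => y; rewrite derive_slice2.
transitivity (\int[mu]_y ('D_1 (fun y => Z (x, y)) y)%:E)%E;
    last apply: (@integral_derive_eq0 (fun y => Z (x, y)) M M0).
- by apply: eq_integral => y _; rewrite derive_slice2.
- move=> y; apply: (@Ck_on_derivable _ _ _ 0 setT) => //.
  exact: (@Ck_on_slice2 _ _ _ _ _ setT).
- by have := cl2 x; rewrite E.
- move=> y My; have nC : ~ C (x, y) by apply: Z0; right.
  by rewrite derive_slice2 DZ0// -ZC.
Qed.

End plane_integration.

(** * Calculus of 2 x 2 matrices *)

Section two_by_two.
Context {R : realType}.
Implicit Types X Y Z : 'M[R]_2.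

Lemma ord2_ind (P : 'I_2 -> Prop) : P 0 -> P 1 -> forall i, P i.
Proof.
move=> P0 P1 [[|[|//]] i2]; [move: P0|move: P1];
  by congr P; apply: val_inj.
Qed.

Lemma matrix2P X Y : X 0 0 = Y 0 0 -> X 0 1 = Y 0 1 -> X 1 0 = Y 1 0 ->
  X 1 1 = Y 1 1 -> X = Y.
Proof.
by move=> ? ? ? ?; apply/matrixP; apply: ord2_ind; apply: ord2_ind.
Qed.

Lemma sum_ord2 (V : nmodType) (F : 'I_2 -> V) : \sum_i F i = F 0 + F 1.
Proof. by rewrite big_ord_recl big_ord1; congr (_ + F _); apply: val_inj. Qed.

Lemma mulmx2E X Y i j : (X *m Y) i j = X i 0 * Y 0 j + X i 1 * Y 1 j.
Proof. by rewrite mxE sum_ord2. Qed.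

Lemma mxtrace2E X : \tr X = X 0 0 + X 1 1.
Proof. exact: sum_ord2. Qed.

Lemma mbarE X i j : mbar X i j = (X 0 0 + X 1 1) * (i == j)%:R - X i j.
Proof. by rewrite /mbar !mxE mxtrace2E mulr_natr. Qed.

Lemma ads_formE X Y : ads_form X Y =
  - (2^-1 * (X 0 0 * Y 1 1 + X 1 1 * Y 0 0 - X 0 1 * Y 1 0 - X 1 0 * Y 0 1)).
Proof. by rewrite /ads_form mxtrace2E !mulmx2E !mbarE /=; ring. Qed.

End two_by_two.

Section matrix_calculus.
Context {R : realType} {V : normedModType R}.
Implicit Types (A B : V -> 'M[R]_2) (r : V -> R) (U : set V) (p v : V).

Lemma Ck_on_entry n U A i j : open U -> Ck_on n U A ->
  Ck_on n U (fun x => A x i j).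
Proof. by move=> oU /Ck_on_mxP; apply. Qed.

Lemma Ck_on_mulmx n U A B : open U -> Ck_on n U A -> Ck_on n U B ->
  Ck_on n U (fun x => A x *m B x).
Proof.
move=> oU cA cB; apply/Ck_on_mxP => // i j.
apply: (@Ck_on_eq _ _ _ _ _ (fun x => A x i 0 * B x 0 j + A x i 1 * B x 1 j)) => //.
  by move=> x _; rewrite mulmx2E.
by apply: Ck_on_add => //; apply: Ck_on_mul => //; exact: Ck_on_entry.
Qed.

Lemma Ck_on_scalemx n U r A : open U -> Ck_on n U r -> Ck_on n U A ->
  Ck_on n U (fun x => r x *: A x).
Proof.
move=> oU cr cA; apply/Ck_on_mxP => // i j.
apply: (@Ck_on_eq _ _ _ _ _ (fun x => r x * A x i j)) => //.
  by move=> x _; rewrite mxE.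
by apply: Ck_on_mul => //; exact: Ck_on_entry.
Qed.

Lemma Ck_on_submx n U A B : open U -> Ck_on n U A -> Ck_on n U B ->
  Ck_on n U (fun x => A x - B x).
Proof.
move=> oU cA cB; apply/Ck_on_mxP => // i j.
apply: (@Ck_on_eq _ _ _ _ _ (fun x => A x i j - B x i j)) => //.
  by move=> x _; rewrite !mxE.
by apply: Ck_on_sub => //; exact: Ck_on_entry.
Qed.

Lemma Ck_on_mbar n U A : open U -> Ck_on n U A ->
  Ck_on n U (fun x => mbar (A x)).
Proof.
move=> oU cA; apply/Ck_on_mxP => // i j.
apply: (@Ck_on_eq _ _ _ _ _
  (fun x => (A x 0 0 + A x 1 1) * (i == j)%:R - A x i j)) => //.
  by move=> x _; rewrite mbarE.
apply: Ck_on_sub => //; last exact: Ck_on_entry.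
apply: Ck_on_mul => //; last exact: Ck_on_cst.
by apply: Ck_on_add => //; exact: Ck_on_entry.
Qed.

Lemma Ck_on_ads n U A B : open U -> Ck_on n U A -> Ck_on n U B ->
  Ck_on n U (fun x => ads_form (A x) (B x)).
Proof.
move=> oU cA cB.
apply: (@Ck_on_eq _ _ _ _ _ (fun x => - 2^-1 * (A x *m mbar (B x)) 0 0 +
   - 2^-1 * (A x *m mbar (B x)) 1 1)) => //.
  by move=> x _; rewrite /ads_form mxtrace2E; ring.
apply: Ck_on_add => //; apply: Ck_on_mul => //;
  try exact: Ck_on_cst; apply: Ck_on_entry => //;
  by apply: Ck_on_mulmx => //; exact: Ck_on_mbar.
Qed.

Lemma derive_lincomb (a b : V -> R) (k l : R) p v :
  derivable a p v -> derivable b p v ->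
  'D_v (fun x => k * a x + l * b x) p = k * 'D_v a p + l * 'D_v b p.
Proof.
move=> da db; rewrite (deriveD (derivableZ (k:=k) da) (derivableZ (k:=l) db)).
by rewrite (deriveZ k da) (deriveZ l db).
Qed.

Lemma derive_mul2 (a b c d : V -> R) p v :
  derivable a p v -> derivable b p v -> derivable c p v -> derivable d p v ->
  'D_v (fun x => a x * b x + c x * d x) p =
    'D_v a p * b p + 'D_v c p * d p + (a p * 'D_v b p + c p * 'D_v d p).
Proof.
move=> da db dc dd.
rewrite (deriveD (derivableM da db) (derivableM dc dd)).
by rewrite (deriveM da db) (deriveM dc dd) -![_ *: _]/(_ * _); ring.
Qed.

Lemma derivable_entry A p v i j : differentiable A p ->
  derivable (fun x => A x i j) p v.
Proof. by move=> dA; exact/diff_derivable/differentiable_entry. Qed.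

Lemma derive_mulmx A B p v : differentiable A p -> differentiable B p ->
  'D_v (fun x => A x *m B x) p = 'D_v A p *m B p + A p *m 'D_v B p.
Proof.
move=> dA dB; have dAe i j := @derivable_entry A p v i j dA.
have dBe i j := @derivable_entry B p v i j dB.
have dAB : differentiable (fun x => A x *m B x) p.
  apply: differentiable_mxP => i j.
  rewrite (_ : (fun _ => _) = (fun x => A x i 0) * (fun x => B x 0 j) +
    (fun x => A x i 1) * (fun x => B x 1 j)); last first.
    by apply/funext => x; rewrite mulmx2E.
  by apply: differentiableD; apply: differentiableM; exact: differentiable_entry.
apply/matrixP => i j; rewrite derive_entry; last exact: diff_derivable.
under eq_fun do rewrite mulmx2E.
rewrite derive_mul2// mxE !mulmx2E.
by rewrite !derive_entry//; exact: diff_derivable.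
Qed.

Lemma derive_scalemx r A p v : differentiable r p -> differentiable A p ->
  'D_v (fun x => r x *: A x) p = 'D_v r p *: A p + r p *: 'D_v A p.
Proof.
move=> dr dA; have dAe i j := @derivable_entry A p v i j dA.
have drA : differentiable (fun x => r x *: A x) p.
  apply: differentiable_mxP => i j.
  rewrite (_ : (fun _ => _) = r * (fun x => A x i j)); last first.
    by apply/funext => x; rewrite mxE.
  by apply: differentiableM => //; exact: differentiable_entry.
apply/matrixP => i j; rewrite derive_entry; last exact: diff_derivable.
under eq_fun do rewrite mxE.
rewrite deriveM//; last exact: diff_derivable.
rewrite !mxE derive_entry; last exact: diff_derivable.
by rewrite addrC -![_ *: _]/(_ * _); congr (_ + _); rewrite mulrC.
Qed.

Lemma derive_mbar A p v : differentiable A p ->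
  'D_v (fun x => mbar (A x)) p = mbar ('D_v A p).
Proof.
move=> dA; have dAe i j := @derivable_entry A p v i j dA.
have E i j : (fun x => mbar (A x) i j) =
    (fun x => (i == j)%:R * (fun x => 1 * A x 0 0 + 1 * A x 1 1) x + (-1) * A x i j).
  by apply/funext => x; rewrite mbarE; ring.
have dD : differentiable (fun x => 1 * A x 0 0 + 1 * A x 1 1) p.
  apply: (@differentiableD _ _ _ (1 \*: fun x => A x 0 0) (1 \*: fun x => A x 1 1));
    by apply: differentiableZ; exact: differentiable_entry.
have dmA : differentiable (fun x => mbar (A x)) p.
  apply: differentiable_mxP => i j; rewrite E.
  apply: (@differentiableD _ _ _ ((i == j)%:R \*: _) ((-1) \*: fun x => A x i j));
    apply: differentiableZ => //; exact: differentiable_entry.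
apply/matrixP => i j; rewrite derive_entry; last exact: diff_derivable.
rewrite E derive_lincomb//; last exact: diff_derivable.
rewrite derive_lincomb// mbarE !derive_entry; try exact: diff_derivable.
by ring.
Qed.

Lemma derive_ads A B p v : differentiable A p -> differentiable B p ->
  'D_v (fun x => ads_form (A x) (B x)) p =
  ads_form ('D_v A p) (B p) + ads_form (A p) ('D_v B p).
Proof.
move=> dA dB; have dAe i j := @derivable_entry A p v i j dA.
have dBe i j := @derivable_entry B p v i j dB.
have E : (fun x => ads_form (A x) (B x)) = (fun x =>
   - 2^-1 * (fun x => A x 0 0 * B x 1 1 + A x 1 1 * B x 0 0) x +
     2^-1 * (fun x => A x 0 1 * B x 1 0 + A x 1 0 * B x 0 1) x).
  by apply/funext => x; rewrite ads_formE; ring.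
have dd i j k l i' j' k' l' :
    derivable (fun x => A x i j * B x k l + A x i' j' * B x k' l') p v.
  exact: (derivableD (derivableM (dAe i j) (dBe k l))
                     (derivableM (dAe i' j') (dBe k' l'))).
rewrite E derive_lincomb// !derive_mul2// !ads_formE !derive_entry;
  try exact: diff_derivable.
by ring.
Qed.

End matrix_calculus.

Fact pd_key : unit. Proof. exact: tt. Qed.

(* Sealed copies of the partial derivatives: unification would otherwise try to
   tell ['D_(1, 0)] from ['D_(0, 1)] by unfolding limits. *)
Definition pd (R : realType) (W : normedModType R) (v : R * R) :
    (R * R -> W) -> R * R -> W :=
  locked_with pd_key (fun F p => 'D_v F p).

Fact ex_sealed (R : realType) : {e : R * R | e = axis R 0}.
Proof. by exists (axis R 0). Qed.

Fact ey_sealed (R : realType) : {e : R * R | e = axis R 1}.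
Proof. by exists (axis R 1). Qed.

Definition ex (R : realType) : R * R := sval (ex_sealed R).

Definition ey (R : realType) : R * R := sval (ey_sealed R).

Section sealed_partial.
Context {R : realType}.
Implicit Types (U : set (R * R)) (p v : R * R) (A B : R * R -> 'M[R]_2).

Lemma pdE (W : normedModType R) v (F : R * R -> W) p : pd v F p = 'D_v F p.
Proof. by rewrite /pd unlock. Qed.

Lemma pd_ex (W : normedModType R) (F : R * R -> W) p : partial 0 F p = pd (ex R) F p.
Proof. by rewrite pdE /ex (svalP (ex_sealed R)). Qed.

Lemma pd_ey (W : normedModType R) (F : R * R -> W) p : partial 1 F p = pd (ey R) F p.
Proof. by rewrite pdE /ey (svalP (ey_sealed R)). Qed.

Lemma Ck_on_pd (W : normedModType R) n U v (F : R * R -> W) :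
  Ck_on n.+1 U F -> Ck_on n U (pd v F).
Proof. by move=> [_ /(_ v)]; rewrite /pd unlock. Qed.

Lemma pd_eq_on (W : normedModType R) U v (F G : R * R -> W) p : open U -> U p ->
  (forall x, U x -> F x = G x) -> pd v F p = pd v G p.
Proof. by move=> oU Up FG; rewrite !pdE; apply: derive_eq_on oU Up FG. Qed.

Lemma pd_cst (W : normedModType R) v (w : W) p : pd v (fun=> w) p = 0.
Proof. by rewrite pdE; apply: derive_cst. Qed.

Lemma pdC U v w A p : open U -> Ck_on 2 U A -> U p ->
  pd w (pd v A) p = pd v (pd w A) p.
Proof.
move=> oU cA Up; have cAe i j := Ck_on_entry i j oU cA.
have dA q z : U q -> derivable A q z by move=> Uq; apply: diff_derivable; exact: cA.1.
have dDA z q y : U q -> derivable ('D_z A) q y.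
  by move=> Uq; apply: diff_derivable; exact: (cA.2 z).1.
have pdfE z B : pd z B = 'D_z B by apply/funext => q; exact: pdE.
have E z y i j : ('D_y ('D_z A) p) i j = 'D_y ('D_z (fun x => A x i j)) p.
  transitivity ('D_y (fun x => ('D_z A x) i j) p).
    exact: (derive_entry i j (dDA z p y Up)).
  by apply: (derive_eq_on _ oU Up) => x Ux; exact: (derive_entry i j (dA x z Ux)).
rewrite !pdfE; apply/matrixP => i j.
transitivity ('D_w ('D_v (fun x => A x i j)) p); first exact: E.
transitivity ('D_v ('D_w (fun x => A x i j)) p); last exact/esym/E.
exact: derive_symmetric oU (cAe i j) Up.
Qed.

Lemma pd_sub v A B p : differentiable A p -> differentiable B p ->
  pd v (fun x => A x - B x) p = pd v A p - pd v B p.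
Proof. by move=> dA dB; rewrite !pdE; apply: deriveB; exact: diff_derivable. Qed.

Lemma pd_mulmx v A B p : differentiable A p -> differentiable B p ->
  pd v (fun x => A x *m B x) p = pd v A p *m B p + A p *m pd v B p.
Proof. by move=> dA dB; rewrite !pdE; exact: derive_mulmx. Qed.

Lemma pd_scalemx v (r : R * R -> R) A p : differentiable r p -> differentiable A p ->
  pd v (fun x => r x *: A x) p = pd v r p *: A p + r p *: pd v A p.
Proof. by move=> dr dA; rewrite !pdE; exact: derive_scalemx. Qed.

Lemma pd_mbar v A p : differentiable A p ->
  pd v (fun x => mbar (A x)) p = mbar (pd v A p).
Proof. by move=> dA; rewrite !pdE; exact: derive_mbar. Qed.

Lemma pd_ads v A B p : differentiable A p -> differentiable B p ->
  pd v (fun x => ads_form (A x) (B x)) p =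
  ads_form (pd v A p) (B p) + ads_form (A p) (pd v B p).
Proof. by move=> dA dB; rewrite !pdE; exact: derive_ads. Qed.

Lemma pd_mul v (a b : R * R -> R) p : differentiable a p -> differentiable b p ->
  pd v (fun x => a x * b x) p = pd v a p * b p + a p * pd v b p.
Proof.
move=> da db; rewrite !pdE (deriveM (diff_derivable da) (diff_derivable db)).
by rewrite addrC -![_ *: _]/(_ * _) (mulrC (b p)).
Qed.

End sealed_partial.

(** * The Lie algebra sl2 and the tangent planes of dS2 *)

Section sl2_algebra.
Context {R : realType}.
Implicit Types (X Y Z U n : 'M[R]_2) (k : R).
Local Notation q := (@ads_form R).

Lemma ads_formC X Y : q X Y = q Y X.
Proof. by rewrite !ads_formE; ring. Qed.

Lemma ads_formDl X Y Z : q (X + Y) Z = q X Z + q Y Z.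
Proof. by rewrite !ads_formE !mxE; ring. Qed.

Lemma ads_formZl k X Z : q (k *: X) Z = k * q X Z.
Proof. by rewrite !ads_formE !mxE; ring. Qed.

Lemma ads_formNl X Z : q (- X) Z = - q X Z.
Proof. by rewrite !ads_formE !mxE; ring. Qed.

Lemma ads_formBl X Y Z : q (X - Y) Z = q X Z - q Y Z.
Proof. by rewrite ads_formDl ads_formNl. Qed.

Lemma ads_formDr X Y Z : q X (Y + Z) = q X Y + q X Z.
Proof. by rewrite !(ads_formC X) ads_formDl. Qed.

Lemma ads_formZr k X Z : q X (k *: Z) = k * q X Z.
Proof. by rewrite !(ads_formC X) ads_formZl. Qed.

Lemma ads_formBr X Y Z : q X (Y - Z) = q X Y - q X Z.
Proof. by rewrite !(ads_formC X) ads_formBl. Qed.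

Lemma det_mx2 X : \det X = X 0 0 * X 1 1 - X 0 1 * X 1 0.
Proof.
rewrite (expand_det_row _ 0) sum_ord2 /cofactor !det_mx11 !mxE /=.
rewrite expr0 expr1 mul1r mulN1r mulrN.
by congr (_ * X _ _ - _ * X _ _); apply: val_inj.
Qed.

Lemma ads_form_det X : q X X = - \det X.
Proof. by rewrite ads_formE det_mx2; field. Qed.

Lemma mul_mbar X : X *m mbar X = (\det X)%:M.
Proof.
by apply: matrix2P; rewrite mulmx2E !mbarE !mxE det_mx2 /= ?mulr1n ?mulr0n; ring.
Qed.

Lemma invmx_mbar X : \det X != 0 -> invmx X = (\det X)^-1 *: mbar X.
Proof.
move=> dX; have uX : X \in unitmx by rewrite unitmxE unitfE.
apply: (can_inj (mulKmx uX)); rewrite mulmxV// -scalemxAr mul_mbar.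
by rewrite scale_scalar_mx mulVf.
Qed.

Lemma ads_form_mull X Y Z : q (X *m Y) (X *m Z) = \det X * q Y Z.
Proof. by rewrite !ads_formE det_mx2 !mulmx2E; ring. Qed.

Lemma tr0_entry X : \tr X = 0 -> X 1 1 = - X 0 0.
Proof. by rewrite mxtrace2E => /eqP; rewrite addrC addr_eq0 => /eqP. Qed.

Lemma ads_form_tr0 X Y : \tr Y = 0 -> q X Y = 2^-1 * \tr (X *m Y).
Proof.
by move=> /tr0_entry Y1; rewrite ads_formE mxtrace2E !mulmx2E Y1; ring.
Qed.

Lemma tr0_anticomm X Y : \tr X = 0 -> \tr Y = 0 ->
  X *m Y + Y *m X = (2 * q X Y)%:M.
Proof.
move=> /tr0_entry X1 /tr0_entry Y1.
apply: matrix2P; rewrite !mxE !sum_ord2 ads_formE ?mulr1n ?mulr0n X1 Y1/=; by field.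
Qed.

(** On trace-free matrices [q (X *m Y) Z] is alternating, hence a volume form on a space of
    dimension three; this is Cramer's rule for it. *)
Lemma cramer3 X Y Z U : \tr X = 0 -> \tr Y = 0 -> \tr Z = 0 -> \tr U = 0 ->
  q (X *m Y) Z *: U = q (Y *m Z) U *: X + q (Z *m X) U *: Y + q (X *m Y) U *: Z.
Proof.
move=> /tr0_entry X1 /tr0_entry Y1 /tr0_entry Z1 /tr0_entry U1.
by apply: matrix2P; rewrite !mxE !ads_formE !mulmx2E X1 Y1 Z1 U1; ring.
Qed.

End sl2_algebra.

Definition tangent (R : realType) (n X : 'M[R]_2) :=
  \tr X = 0 /\ ads_form X n = 0.

(** For trace-free [n] this is [tr (X Y n) / 2], the volume form of sl2 with [n] inserted. It is a
    signed area on the tangent plane, polynomial in its arguments, where the root of a Gram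
    determinant would be neither. *)
Definition area_form (R : realType) (n X Y : 'M[R]_2) := ads_form (X *m Y) n.

Section tangent_plane.
Context {R : realType} (n : 'M[R]_2) (n_dS2 : dS2 n).
Implicit Types X Y Z W : 'M[R]_2.
Local Notation q := (@ads_form R).
Local Notation T := (tangent n).
Local Notation w := (area_form n).

Let trn : \tr n = 0. Proof. by case: n_dS2. Qed.
Let qnn : q n n = 1. Proof. by case: n_dS2. Qed.

Lemma dS2_sq : n *m n = 1%:M.
Proof.
have := tr0_anticomm trn trn; rewrite qnn mulr1 => E.
apply: (scalerI (a := 2)); first by rewrite pnatr_eq0.
by rewrite scaler_nat mulr2n E scale_scalar_mx mulr1.
Qed.

Lemma tangent_anticomm X : T X -> X *m n = - (n *m X).
Proof.
move=> [trX qX]; apply/eqP; rewrite -addr_eq0; apply/eqP.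
by rewrite tr0_anticomm// qX mulr0 raddf0.
Qed.

(** Left multiplication by [n] is the para-complex structure of the Lorentzian tangent plane: an
    involution, as [n] squares to the identity, which exchanges the metric and the area form. *)
Lemma tangentJ X : T X -> T (n *m X).
Proof.
move=> [trX qX]; split.
  have := ads_form_tr0 n trX; rewrite ads_formC qX => /esym/eqP.
  by rewrite mulf_eq0 invr_eq0 pnatr_eq0 => /eqP.
rewrite -[X in q _ X]mulmx1 ads_form_mull ads_formE !mxE/= mulr0n mulr1n.
by rewrite (tr0_entry trX); ring.
Qed.

Lemma tangentD X Y : T X -> T Y -> T (X + Y).
Proof.
by move=> [tX qX] [tY qY]; split; rewrite ?mxtraceD ?ads_formDl ?tX ?qX ?tY ?qY addr0.
Qed.

Lemma tangentZ k X : T X -> T (k *: X).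
Proof.
by move=> [tX qX]; split; rewrite ?mxtraceZ ?ads_formZl ?tX ?qX mulr0.
Qed.

Lemma tangentB X Y : T X -> T Y -> T (X - Y).
Proof.
by move=> TX TY; rewrite -scaleN1r; apply: tangentD => //; exact: tangentZ.
Qed.

Lemma area_formC X Y : T X -> T Y -> w X Y = - w Y X.
Proof.
move=> [tX qX] [tY qY]; rewrite /area_form !ads_formE !mulmx2E.
by rewrite (tr0_entry trn) (tr0_entry tX) (tr0_entry tY); ring.
Qed.

Lemma area_formDl X Y Z : w (X + Y) Z = w X Z + w Y Z.
Proof. by rewrite /area_form mulmxDl ads_formDl. Qed.

Lemma area_formDr X Y Z : w X (Y + Z) = w X Y + w X Z.
Proof. by rewrite /area_form mulmxDr ads_formDl. Qed.

Lemma area_formZl k X Z : w (k *: X) Z = k * w X Z.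
Proof. by rewrite /area_form -scalemxAl ads_formZl. Qed.

Lemma area_formZr k X Z : w X (k *: Z) = k * w X Z.
Proof. by rewrite /area_form -scalemxAr ads_formZl. Qed.

Lemma area_formBl X Y Z : w (X - Y) Z = w X Z - w Y Z.
Proof. by rewrite /area_form mulmxBl ads_formBl. Qed.

Lemma area_formBr X Y Z : w X (Y - Z) = w X Y - w X Z.
Proof. by rewrite /area_form mulmxBr ads_formBl. Qed.

Lemma area_formXX X : T X -> w X X = 0.
Proof.
by move=> TX; have := area_formC TX TX; lra.
Qed.

Lemma area_formJl X Y : T X -> T Y -> w (n *m X) Y = q X Y.
Proof.
move=> [tX qX] [tY qY]; rewrite /area_form -mulmxA.
rewrite -[X in q _ X]mulmx1 ads_form_mull -[\det n]opprK -ads_form_det qnn.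
rewrite !ads_formE !mulmx2E !mxE/= mulr0n mulr1n (tr0_entry tX) (tr0_entry tY).
by ring.
Qed.

Lemma area_formJr X Y : T X -> T Y -> w X (n *m Y) = - q X Y.
Proof.
move=> TX TY; rewrite area_formC//; last exact: tangentJ.
by rewrite area_formJl// ads_formC.
Qed.

Lemma ads_formJ X Y : \tr Y = 0 -> q (n *m X) Y = w X Y.
Proof.
by move=> tY; rewrite /area_form !ads_form_tr0// -mulmxA mxtrace_mulC.
Qed.

(** Both factors anticommute with [n], so the product commutes with it. The trace-free part of the
    product then also commutes with [n], and is therefore a multiple of [n]. *)
Lemma tangent_mul X Y : T X -> T Y -> X *m Y = (q X Y)%:M + w X Y *: n.
Proof.
move=> TX TY; pose C := X *m Y - (q X Y)%:M.
have tC : \tr C = 0.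
  have [tY _] := TY; rewrite linearB/= mxtrace_scalar (ads_form_tr0 _ tY).
  by rewrite mulr2n; field.
have nC : n *m C = C *m n.
  rewrite mulmxBr mulmxBl scalar_mxC; congr (_ - _).
  rewrite -[RHS]mulmxA (tangent_anticomm TY) mulmxN (mulmxA X).
  by rewrite (tangent_anticomm TX) mulNmx opprK mulmxA.
have nCq : n *m C = (q n C)%:M.
  apply: (scalerI (a := 2)); first by rewrite pnatr_eq0.
  by rewrite scaler_nat mulr2n {2}nC tr0_anticomm// scale_scalar_mx.
have CE : C = q n C *: n.
  by rewrite -[LHS]mul1mx -dS2_sq -mulmxA nCq mul_mx_scalar.
have qnC : q n C = w X Y.
  rewrite ads_formC ads_formBl -/(w X Y) [X in _ - X](_ : _ = 0) ?subr0//.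
  by rewrite (ads_form_tr0 _ trn) mul_scalar_mx mxtraceZ trn !mulr0.
by rewrite -qnC -CE addrC subrK.
Qed.

(** Three vectors of one plane have zero triple product; Cramer's rule applied to the normal [n]
    leaves this linear relation. *)
Lemma area_form_cyclic X Y Z : T X -> T Y -> T Z ->
  w X Y *: Z + w Y Z *: X + w Z X *: Y = 0.
Proof.
move=> TX TY TZ; case: (TX) (TY) (TZ) => tX qX [tY qY] [tZ qZ].
have qXYZ : q (X *m Y) Z = 0.
  rewrite tangent_mul// ads_formDl ads_formZl (ads_formC n) qZ mulr0 addr0.
  by rewrite (ads_form_tr0 _ tZ) mul_scalar_mx mxtraceZ tZ !mulr0.
have := cramer3 tX tY tZ trn; rewrite qXYZ scale0r => E.
by rewrite -addrA addrC -E.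
Qed.

(** The cyclic relation for [X], [Y] and [n *m Z], in which two of the areas turn into scalar
    products. Gram determinants, the closed form of the fluxes and nondegeneracy all come from
    it. *)
Lemma gram_cofactor X Y Z : T X -> T Y -> T Z ->
  q Z Y *: X - q Z X *: Y = w X Y *: (n *m Z).
Proof.
move=> TX TY TZ; have := area_form_cyclic TX TY (tangentJ TZ).
rewrite area_formJr// area_formJl// (ads_formC Y) (scaleNr (q Z Y)) => /eqP.
by rewrite -addrA addr_eq0 opprD opprK => /eqP ->.
Qed.

Lemma tangent_mul_sub X Y Z W : T X -> T Y -> T Z -> T W -> q X Y = q Z W ->
  X *m Y - Z *m W = (w X Y - w Z W) *: n.
Proof.
move=> TX TY TZ TW qq; rewrite (tangent_mul TX TY) (tangent_mul TZ TW) qq.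
by rewrite opprD addrACA subrr add0r scalerBl.
Qed.

Lemma tangent_independent X Y (x y : R) : T X -> T Y -> w X Y != 0 ->
  x *: Y - y *: X = 0 -> x = 0 /\ y = 0.
Proof.
move=> TX TY wXY E; have w0 Z : w Z (x *: Y - y *: X) = 0.
  by rewrite E /area_form mulmx0 ads_formE !mxE; ring.
have := w0 X; have := w0 Y; rewrite !area_formBr !area_formZr.
rewrite (area_formXX TX) (area_formXX TY) (area_formC TY TX) !mulr0 subr0 sub0r.
rewrite mulrN opprK => /eqP + /eqP; rewrite !mulf_eq0 (negbTE wXY) !orbF.
by move=> /eqP -> /eqP ->.
Qed.

Lemma tangent_nondegenerate X Y Z : T X -> T Y -> T Z -> w X Y != 0 ->
  q X Z = 0 -> q Y Z = 0 -> Z = 0.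
Proof.
move=> TX TY TZ w0 XZ YZ; have := gram_cofactor TX TY TZ.
rewrite (ads_formC Z X) (ads_formC Z Y) XZ YZ (scale0r X) (scale0r Y) subr0.
move=> /esym/eqP; rewrite scaler_eq0 (negbTE w0) => /eqP nZ.
by rewrite -[LHS]mul1mx -dS2_sq -mulmxA nZ mulmx0.
Qed.

Section frame.
Variables a0 a1 s0 s1 : 'M[R]_2.
Hypotheses (Ta0 : T a0) (Ta1 : T a1) (Ts0 : T s0) (Ts1 : T s1).

(** The Cauchy-Binet formula for two frames of a plane, the minus sign being that of its Lorentzian
    signature. It yields the determinants of both fundamental forms. *)
Lemma det_gram : q a0 s0 * q a1 s1 - q a0 s1 * q a1 s0 = - (w a0 a1 * w s0 s1).
Proof.
have := congr1 (q a0) (gram_cofactor Ts0 Ts1 Ta1).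
rewrite ads_formBr !ads_formZr (ads_formC a0 (n *m a1)) ads_formJ ?(proj1 Ta0)//.
by rewrite (area_formC Ta1 Ta0) => E; rewrite mulrC (mulrC (q a0 s1)) E; ring.
Qed.

Hypothesis sym : q a0 s1 = q a1 s0.

(** For the surface, [n *m a0 - s0] and [n *m a1 - s1] are the derivatives of the Gauss map, and the
    left side is a multiple of the first energy flux. Two instances of [gram_cofactor], one
    multiplied by [n], combine by the symmetry of the second fundamental form. *)
Lemma gram_gauss0 :
  q a1 s1 *: (n *m a0 - s0) - q a0 s1 *: (n *m a1 - s1) =
  w a0 a1 *: s1 - w s0 s1 *: (n *m a1).
Proof.
have := congr1 (mulmx n) (gram_cofactor Ta0 Ta1 Ts1).
rewrite mulmxBr -!scalemxAr mulmxA dS2_sq mul1mx => E.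
rewrite -E -(gram_cofactor Ts0 Ts1 Ta1) !(ads_formC s1) !scalerBr sym.
by rewrite !opprD !opprK !addrA; congr (_ + _); rewrite addrAC.
Qed.

Lemma gram_gauss1 :
  q a0 s0 *: (n *m a1 - s1) - q a0 s1 *: (n *m a0 - s0) =
  w s0 s1 *: (n *m a0) - w a0 a1 *: s0.
Proof.
have := congr1 (mulmx n) (gram_cofactor Ta0 Ta1 Ts0).
rewrite mulmxBr -!scalemxAr mulmxA dS2_sq mul1mx => <-.
rewrite -(gram_cofactor Ts0 Ts1 Ta0) !(ads_formC s0) -sym.
move: (n *m a0) (n *m a1) => u0 u1.
by apply/matrixP => i j; rewrite !mxE; ring.
Qed.

Lemma area_gauss : w (n *m a0 - s0) (n *m a1 - s1) = w s0 s1 - w a0 a1.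
Proof.
rewrite area_formBl !area_formBr area_formJl//; last exact: tangentJ.
rewrite (ads_formC a0) ads_formJ ?(proj1 Ta0)// area_formJl// area_formJr//.
by rewrite (area_formC Ta1 Ta0) sym (ads_formC s0); ring.
Qed.

(** The mixed terms are [k] times [q a0 s1] and [q a1 s0] with opposite signs, so [sym] cancels
    them, and multiplication by [n] reverses areas. The case [k = -1] is that of the Gauss map;
    [k = d ^ 2] occurs in the tension. *)
Lemma area_conjugate k :
  w (n *m a0 + k *: s0) (n *m a1 + k *: s1) = k ^+ 2 * w s0 s1 - w a0 a1.
Proof.
rewrite area_formDl !area_formDr !area_formZl !area_formZr.
rewrite area_formJl//; last exact: tangentJ.
rewrite (ads_formC a0) ads_formJ ?(proj1 Ta0)// area_formJl// area_formJr//.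
by rewrite (area_formC Ta1 Ta0) sym (ads_formC s0); ring.
Qed.

End frame.

(** Nilpotent matrices span sl2, on which the scalar product is nondegenerate; the two off-diagonal
    matrix units and one more nilpotent form a basis. *)
Lemma nilpotent_test W : \tr W = 0 ->
  (forall X, X *m X = 0 -> q X W = 0) -> W = 0.
Proof.
move=> /tr0_entry W1 qW.
have W01 : W 0 1 = 0.
  have := qW (delta_mx 1 0); rewrite mul_delta_mx_0// ads_formE !mxE/= => /(_ erefl).
  lra.
have W10 : W 1 0 = 0.
  have := qW (delta_mx 0 1); rewrite mul_delta_mx_0// ads_formE !mxE/= => /(_ erefl).
  lra.
have W00 : W 0 0 = 0.
  (* Both rows are [(1, -1)], so the square is zero; once the off-diagonal entries of [W] are gone,
     the product with [W] is [W 0 0]. *)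
  pose X : 'M[R]_2 := \matrix_(i, j) (if j == 0 then 1 else -1).
  have := qW X; rewrite ads_formE !mxE/= W1 W01 W10 => qX.
  have : X *m X = 0 by apply: matrix2P; rewrite mulmx2E !mxE/=; ring.
  by move/qX; lra.
by apply: matrix2P; rewrite ?W1 !mxE ?W00 ?oppr0.
Qed.

(** The matrix is the conjugate of [n] by [1 + s X], whose inverse is [1 - s X]; conjugation
    preserves trace and determinant, which cut out [dS2]. *)
Lemma dS2_nilpotent_conj (s : R) X : X *m X = 0 ->
  dS2 (n + (s *: (X *m n - n *m X) - s ^+ 2 *: (X *m n *m X))).
Proof.
move=> XX; have E : n + (s *: (X *m n - n *m X) - s ^+ 2 *: (X *m n *m X)) =
    (1%:M + s *: X) *m n *m (1%:M - s *: X).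
  rewrite mulmxDl mul1mx mulmxDl !mulmxBr !mulmx1 -!scalemxAl -!scalemxAr.
  move: (X *m n *m X) (X *m n) (n *m X) => x y z.
  by apply/matrixP => i j; rewrite !mxE; ring.
have inv : (1%:M - s *: X) *m (1%:M + s *: X) = 1%:M.
  rewrite mulmxDr mulmx1 mulmxBl mul1mx -scalemxAl -scalemxAr XX !scaler0 subr0.
  by rewrite subrK.
rewrite E; split; first by rewrite mxtrace_mulC mulmxA inv mul1mx.
rewrite /= ads_form_det -[RHS]qnn ads_form_det !det_mulmx.
by rewrite mulrAC -det_mulmx (mulmx1C inv) det1 mul1r.
Qed.

(** By invariance of the trace form, pairing [[X, n]] with [E] is pairing [X] with [[n, E]]. The
    latter is [2 n U], because [n] commutes with [l n] and anticommutes with [U]; [nilpotent_test]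
    applies to [n U]. *)
Lemma nilpotent_commutator_test (l : R) U : T U ->
  (forall X, X *m X = 0 -> q (X *m n - n *m X) (l *: n + U) = 0) -> U = 0.
Proof.
move=> TU qU; have [tU _] := TU.
have tE : \tr (l *: n + U) = 0 by rewrite mxtraceD mxtraceZ trn tU mulr0 addr0.
suff nU : n *m U = 0 by rewrite -[U]mul1mx -dS2_sq -mulmxA nU mulmx0.
apply: nilpotent_test => [|X X0]; first by case: (tangentJ TU).
have := qU X X0; set E := l *: n + U in tE *.
have nE : n *m E - E *m n = 2 *: (n *m U).
  rewrite mulmxDr mulmxDl (tangent_anticomm TU) -scalemxAr -scalemxAl.
  by rewrite opprD addrACA subrr add0r opprK scaler_nat mulr2n.
have -> : q (X *m n - n *m X) E = 2 * q X (n *m U).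
  rewrite (ads_form_tr0 _ tE) (ads_form_tr0 _ (proj1 (tangentJ TU))).
  rewrite mulmxBl linearB/= -!mulmxA (mxtrace_mulC n) -mulmxA -linearB/= -mulmxBr.
  by rewrite nE -scalemxAr mxtraceZ; ring.
by move=> /eqP; rewrite mulf_eq0 pnatr_eq0/= => /eqP.
Qed.

End tangent_plane.

(** * First variation of a quadratic energy *)

Section estimates.
Context {R : realType}.

Lemma continuous_bounded_on {V : normedModType R} (C U : set V) (u : V -> R) :
  compact C -> C `<=` U -> (forall p, U p -> {for p, continuous u}) ->
  exists2 K : R, 0 <= K & forall p, C p -> `|u p| <= K.
Proof.
move=> cC CU cu; have [|M [_ Mu]] := @compact_bounded _ _ (u @` C).
  apply: continuous_compact => //; apply: continuous_in_subspaceT => p.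
  by rewrite inE => /CU/cu.
exists (`|M| + 1); first by rewrite addr_ge0.
move=> p Cp; apply: Mu; last by exists p.
by rewrite (le_lt_trans (ler_norm _))// ltrDl.
Qed.

Lemma quadratic_is_derive (e : R -> R) (d M r : R) : 0 < r ->
  (forall t, `|t| < r -> `|e t - e 0 - t * d| <= M * t ^+ 2) ->
  is_derive (0 : R) (1 : R) e d.
Proof.
move=> r0 He.
have cvd : h^-1 *: (e (h *: 1 + 0) - e 0) @[h --> 0^'] --> d.
  apply/cvgrPdist_le => eps eps0.
  (* The sign of [M] is not prescribed; [|M| + 1] is positive in any case and bounds [M]. *)
  pose dl := Num.min r (eps / (`|M| + 1)).
  have M1 : 0 < `|M| + 1 by rewrite ltr_wpDl.
  have dl0 : 0 < dl by rewrite lt_min r0 divr_gt0.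
  exists dl => //= h /=; rewrite sub0r normrN => hdl h0.
  have hr : `|h| < r by apply: lt_le_trans hdl _; rewrite ge_min lexx.
  have he : `|h| * (`|M| + 1) <= eps.
    by rewrite -ler_pdivlMr//; apply/ltW/(lt_le_trans hdl); rewrite ge_min lexx orbT.
  have -> : h^-1 *: (e (h *: 1 + 0) - e 0) = h^-1 * (e h - e 0).
    by rewrite addr0 /GRing.scale/= mulr1.
  rewrite -(ler_pM2l (_ : 0 < `|h|)) ?normr_gt0// -normrM mulrBr mulVKf//.
  rewrite distrC (le_trans (He _ hr))//.
  have hh : `|h| * (`|h| * (`|M| + 1)) <= `|h| * eps by rewrite ler_wpM2l.
  apply: le_trans hh; rewrite mulrA -expr2 real_normK ?num_real// mulrC.
  rewrite ler_wpM2l ?sqr_ge0// (le_trans (ler_norm _))//.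
  by rewrite lerDl.
split; first by apply/cvg_ex; exists d.
exact: cvg_lim cvd.
Qed.

Lemma ads_form_bound (X Y : 'M[R]_2) (k l : R) : 0 <= k -> 0 <= l ->
  (forall i j, `|X i j| <= k) -> (forall i j, `|Y i j| <= l) ->
  `|ads_form X Y| <= 2 * (k * l).
Proof.
move=> k0 l0 Xk Yl; rewrite ads_formE normrN normrM.
have XY i j i' j' : `|X i j * Y i' j'| <= k * l.
  by rewrite normrM ler_pM.
have -> : `|2^-1 : R| = 2^-1 by rewrite ger0_norm.
rewrite (_ : 2 * (k * l) = 2^-1 * (k * l + k * l + k * l + k * l)); last by field.
rewrite ler_wpM2l// (le_trans (ler_normB _ _))// lerD//.
rewrite (le_trans (ler_normB _ _))// lerD//.
by rewrite (le_trans (ler_normD _ _))// lerD.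
Qed.

End estimates.

Section plane_Rintegral.
Context {R : realType} (C : set (R * R)) (cC : compact C).
Notation mu := (@lebesgue_measure R).
Notation mu2 := (mu \x mu)%E.
Implicit Types u v : R * R -> R.
Let mC := compact_measurable2 cC.
Local Notation integrable2 u := (mu2.-integrable C (EFin \o u)).

Lemma Rintegral2D u v : integrable2 u -> integrable2 v ->
  \int[mu2]_(p in C) (u p + v p) = \int[mu2]_(p in C) u p + \int[mu2]_(p in C) v p.
Proof. exact: (@RintegralD _ _ _ mu2 C u v mC). Qed.

Lemma Rintegral2B u v : integrable2 u -> integrable2 v ->
  \int[mu2]_(p in C) (u p - v p) = \int[mu2]_(p in C) u p - \int[mu2]_(p in C) v p.
Proof. exact: (@RintegralB _ _ _ mu2 C u v mC). Qed.

Lemma Rintegral2Z u k : integrable2 u ->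
  \int[mu2]_(p in C) (k * u p) = k * \int[mu2]_(p in C) u p.
Proof. exact: (@RintegralZl _ _ _ mu2 C u k mC). Qed.

Lemma Rintegral2_bound u (B : R) : integrable2 u ->
  (forall p, C p -> `|u p| <= B) ->
  `|\int[mu2]_(p in C) u p| <= B * fine (mu2 C).
Proof.
move=> iu uB.
apply: (le_trans (@le_normr_Rintegral _ _ _ mu2 C u mC iu)).
rewrite -(@Rintegral_cst _ _ _ mu2 C mC).
apply: (@le_Rintegral _ _ _ mu2 C _ _ mC _ _ uB).
- exact: (@integrable_norm _ _ _ mu2 C u iu).
- by apply: (continuous_integrable2 openT cC (@subsetT _ _)) => p _; exact: cvg_cst.
Qed.

End plane_Rintegral.

Section time_lipschitz.
Context {R : realType} {V : normedModType R}.
Variables (Omega C : set V) (eps : R).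
Hypotheses (Omega_open : open Omega) (cC : compact C) (CO : C `<=` Omega).
Hypothesis eps0 : 0 < eps.
Local Notation S := [set z : R * V | `|z.1| < eps /\ Omega z.2].

Lemma open_time_domain : open S.
Proof.
rewrite openE => -[t p] [/= te Op].
have nt : nbhs t [set s : R | `|s| < eps].
  exact: (cvgr_lt _ (@norm_continuous _ _ t) _ te).
have np : nbhs p Omega by exact: (open_nbhs_nbhs (conj Omega_open Op)).
by exists ([set s : R | `|s| < eps], Omega).
Qed.

(** The time derivative is bounded on the compact product of [C] with the closed interval of half
    length, and the mean value theorem is applied in time only. Halving [eps] keeps that closed
    interval inside the open domain. *)
Lemma time_lipschitz (u : R * V -> R) : Ck_on 1 S u ->
  exists2 K : R, 0 <= K & forall t p, `|t| <= eps / 2 -> C p ->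
    `|u (t, p) - u (0, p)| <= K * `|t|.
Proof.
move=> cu.
pose T := [set t : R | `|t| <= eps / 2] `*` C.
have cT : compact T.
  apply: compact_setX => //; rewrite (_ : mkset _ = `[- (eps / 2), eps / 2]%classic).
    exact: segment_compact.
  by apply/seteqP; split=> t /=; rewrite in_itv/= ler_norml.
have e2 : eps / 2 < eps by rewrite gtr_pMr// invf_lt1// ltr1n.
have TS : T `<=` S.
  by move=> [t p] [/= te Cp]; split => /=; [exact: le_lt_trans e2|exact: CO].
have [K K0 uK] := continuous_bounded_on cT TS (cu.2 (1, 0)).
exists K => // t p te Cp.
have line (s0 s : R) : (s0, p) + s *: (1, 0) = (s0 + s, p) :> R * V.
  by congr (_, _); rewrite /= ?scaler0 ?addr0// -[s *: 1]/(s * 1) mulr1.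
have incr a b : a < b -> `|a| <= eps / 2 -> `|b| <= eps / 2 ->
    `|u (b, p) - u (a, p)| <= K * (b - a).
  rewrite -subr_gt0 => ab aeps beps.
  have /andP[a1 a2] : - (eps / 2) <= a <= eps / 2 by rewrite -ler_norml.
  have /andP[b1 b2] : - (eps / 2) <= b <= eps / 2 by rewrite -ler_norml.
  have inT s : 0 <= s <= b - a -> T (a + s, p).
    move=> /andP[s0 sba]; split => //=.
    by rewrite ler_norml; apply/andP; split; lra.
  have [s sba|c /andP[c0 cba]] :=
      directional_MVT (u := u) (p := (a, p)) (v := (1, 0)) ab.
    by rewrite line; apply/cu.1/TS/inT.
  rewrite !line subrKC => ->; rewrite normrM (gtr0_norm ab) mulrC (ler_wpM2r (ltW ab))//.
  by apply/uK/inT; rewrite !ltW.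
have z2 : `|0 : R| <= eps / 2 by rewrite normr0 divr_ge0// ltW.
have [t0|t0|->] := ltgtP t 0; last by rewrite subrr normr0 mulr0.
- by rewrite distrC (ltr0_norm t0) -[- t]sub0r; exact: incr.
- by rewrite (gtr0_norm t0) -[X in K * X]subr0; exact: incr.
Qed.

Lemma time_lipschitz_mx (A : R * V -> 'M[R]_2) : Ck_on 1 S A ->
  exists2 K : R, 0 <= K & forall t p, `|t| <= eps / 2 -> C p ->
    forall i j, `|(A (t, p) - A (0, p)) i j| <= K * `|t|.
Proof.
move=> cA; have cAe i j := Ck_on_entry i j open_time_domain cA.
have [k00 K00 H00] := time_lipschitz (cAe 0 0).
have [k01 K01 H01] := time_lipschitz (cAe 0 1).
have [k10 K10 H10] := time_lipschitz (cAe 1 0).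
have [k11 K11 H11] := time_lipschitz (cAe 1 1).
exists (k00 + k01 + (k10 + k11)); first by rewrite !addr_ge0.
move=> t p te Cp; pose s := `|t|; have s0 : 0 <= s := normr_ge0 t.
have := (mulr_ge0 K00 s0, mulr_ge0 K01 s0, mulr_ge0 K10 s0, mulr_ge0 K11 s0).
move=> [[[? ?] ?] ?].
have := (H00 t p te Cp, H01 t p te Cp, H10 t p te Cp, H11 t p te Cp).
move=> [[[h00 h01] h10] h11].
apply: ord2_ind; apply: ord2_ind; rewrite !mxE; [apply: (le_trans h00)|
  apply: (le_trans h01)|apply: (le_trans h10)|apply: (le_trans h11)];
  by rewrite !mulrDl -/s; lra.
Qed.

End time_lipschitz.

Definition half_quadratic (R : realType) (a00 a01 a11 : R) (X Y : 'M[R]_2) : R :=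
  2^-1 * (a00 * ads_form X X + 2 * (a01 * ads_form X Y) + a11 * ads_form Y Y).

Lemma half_quadratic_expansion (R : realType) (a00 a01 a11 : R)
    (n0 n1 f0 f1 : 'M[R]_2) (Q := half_quadratic a00 a01 a11) :
  Q f0 f1 - Q n0 n1 =
  ads_form (f0 - n0) (a00 *: n0 + a01 *: n1) +
  ads_form (f1 - n1) (a01 *: n0 + a11 *: n1) + Q (f0 - n0) (f1 - n1).
Proof. by rewrite /Q /half_quadratic !ads_formE !mxE; field. Qed.

Section first_variation.
Context {R : realType}.
Notation mu := (@lebesgue_measure R).
Notation mu2 := (mu \x mu)%E.
Notation ex := (@ex R).
Notation ey := (@ey R).
Variables (Omega : set (R * R)) (h nu V0 V1 : R * R -> 'M[R]_2).
Variables a00 a01 a11 : R * R -> R.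
Hypothesis Omega_open : open Omega.
Hypothesis nu_smooth : smooth_on Omega nu.
Hypotheses (a00_cont : Ck_on 0 Omega a00) (a01_cont : Ck_on 0 Omega a01)
  (a11_cont : Ck_on 0 Omega a11).
Let Q p := half_quadratic (a00 p) (a01 p) (a11 p).
Hypothesis energy_densityQ : forall F p, Omega p ->
  energy_density h F p = Q p (pd ex F p) (pd ey F p).
Hypotheses (V0_C1 : Ck_on 1 Omega V0) (V1_C1 : Ck_on 1 Omega V1).
Hypothesis V0E : forall p, Omega p ->
  V0 p = a00 p *: pd ex nu p + a01 p *: pd ey nu p.
Hypothesis V1E : forall p, Omega p ->
  V1 p = a01 p *: pd ex nu p + a11 p *: pd ey nu p.

(** This divergence is taken in the ambient matrix space, without projection to the tangent plane of
    [dS2]. The fluxes are given as C1 functions of their own, so the coefficients of the quadratic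
    form need only be continuous. *)
Definition tension p : 'M[R]_2 := pd ex V0 p + pd ey V1 p.

Let divergence (G : R * R -> 'M[R]_2) p : R :=
  pd ex (fun p => ads_form (G p) (V0 p)) p +
  pd ey (fun p => ads_form (G p) (V1 p)) p.

Let rem (G : R * R -> 'M[R]_2) p := Q p (pd ex G p) (pd ey G p).

Let energy_density_diff F p : Ck_on 1 Omega F -> Omega p ->
  energy_density h F p - energy_density h nu p =
  divergence (fun p => F p - nu p) p - ads_form (F p - nu p) (tension p) +
  rem (fun p => F p - nu p) p.
Proof.
move=> cF Op; have dF := cF.1 p Op; have dnu := (nu_smooth 1).1 p Op.
have dG : differentiable (fun p => F p - nu p) p by exact: differentiableB.
rewrite (energy_densityQ F Op) (energy_densityQ nu Op) /rem /divergence.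
rewrite (pd_ads ex dG (V0_C1.1 p Op)) (pd_ads ey dG (V1_C1.1 p Op)).
rewrite (pd_sub ex dF dnu) (pd_sub ey dF dnu) (V0E Op) (V1E Op).
rewrite (half_quadratic_expansion (a00 p) (a01 p) (a11 p)) /tension.
rewrite (ads_formDr (F p - nu p) (pd ex V0 p) (pd ey V1 p)).
move: (ads_form (F p - nu p) (pd ex V0 p)) (ads_form (F p - nu p) (pd ey V1 p)).
by move=> x y; rewrite addrACA addrK.
Qed.

Variables (C : set (R * R)) (eps : R) (F : R * (R * R) -> 'M[R]_2).
Hypotheses (cC : compact C) (CO : C `<=` Omega) (eps0 : 0 < eps).
Hypothesis F_var : dS2_variation Omega nu C eps F.
Local Notation S := [set z : R * (R * R) | `|z.1| < eps /\ Omega z.2].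
Let F_smooth n : Ck_on n S F. Proof. by case: F_var. Qed.
Let F0 p : Omega p -> F (0, p) = nu p. Proof. by case: F_var => _ _ + _; apply. Qed.
Let G (t : R) (p : R * R) : 'M[R]_2 := F (t, p) - nu p.

Let slice_smooth t n : `|t| < eps -> Ck_on n Omega (fun p => F (t, p)).
Proof. by move=> te; apply: Ck_on_slice2 (F_smooth n) => p Op; split. Qed.

Let half_lt (t : R) : `|t| <= eps / 2 -> `|t| < eps.
Proof. by move=> te; rewrite (le_lt_trans te)// gtr_pMr// invf_lt1// ltr1n. Qed.

Lemma variation_lipschitz : exists2 K : R, 0 <= K &
  forall t p, `|t| <= eps / 2 -> C p -> forall i j, `|G t p i j| <= K * `|t|.
Proof.
have [K K0 FK] := time_lipschitz_mx Omega_open cC CO eps0 (F_smooth 1).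
exists K => // t p te Cp i j; rewrite /G -F0; last exact: CO.
exact: FK.
Qed.

Lemma variation_pd_lipschitz v : exists2 K : R, 0 <= K &
  forall t p, `|t| <= eps / 2 -> C p ->
  forall i j, `|pd v (G t) p i j| <= K * `|t|.
Proof.
have cDF : Ck_on 1 S ('D_(0, v) F) by exact: (F_smooth 2).2.
have [K K0 FK] := time_lipschitz_mx Omega_open cC CO eps0 cDF.
exists K => // t p te Cp i j; have Op := CO Cp.
have -> : pd v (G t) p = 'D_(0, v) F (t, p) - 'D_(0, v) F (0, p).
  rewrite (pd_sub v ((slice_smooth 1 (half_lt te)).1 p Op) ((nu_smooth 1).1 p Op)).
  rewrite pdE derive_slice2; congr (_ - _).
  rewrite -derive_slice2 pdE; apply: (derive_eq_on _ Omega_open Op) => x Ox.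
  by rewrite F0.
exact: FK.
Qed.

Let continuous_integrable (u : R * R -> R) : Ck_on 0 Omega u ->
  mu2.-integrable C (EFin \o u).
Proof. by move=> cu; exact: (continuous_integrable2 Omega_open cC CO cu). Qed.

Lemma Ck_on_tension : Ck_on 0 Omega tension.
Proof.
by apply: (Ck_on_add Omega_open); [exact: (Ck_on_pd ex V0_C1)|exact: (Ck_on_pd ey V1_C1)].
Qed.

Let Ck_on_Q (X Y : R * R -> 'M[R]_2) : Ck_on 0 Omega X -> Ck_on 0 Omega Y ->
  Ck_on 0 Omega (fun p => Q p (X p) (Y p)).
Proof.
move=> cX cY; have oO := Omega_open.
have cq (A B : R * R -> 'M[R]_2) (a : R * R -> R) :
    Ck_on 0 Omega a -> Ck_on 0 Omega A -> Ck_on 0 Omega B ->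
    Ck_on 0 Omega (fun p => a p * ads_form (A p) (B p)).
  by move=> ca cA cB; exact: (Ck_on_mul oO ca (Ck_on_ads oO cA cB)).
apply: (Ck_on_mul oO); first exact: Ck_on_cst.
apply: (Ck_on_add oO); last exact: cq.
apply: (Ck_on_add oO); first exact: cq.
by apply: (Ck_on_mul oO); [exact: Ck_on_cst|exact: cq].
Qed.

Let Ck_on_energy_density X : Ck_on 1 Omega X -> Ck_on 0 Omega (energy_density h X).
Proof.
move=> cX; apply: (@Ck_on_eq _ _ _ _ _ _ _ Omega_open
  (fun p Op => esym (energy_densityQ X Op))).
by apply: Ck_on_Q; exact: Ck_on_pd.
Qed.

Let Q_bound (K A0 A1 A2 : R) p (X Y : 'M[R]_2) : 0 <= K ->
  `|a00 p| <= A0 -> `|a01 p| <= A1 -> `|a11 p| <= A2 ->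
  (forall i j, `|X i j| <= K) -> (forall i j, `|Y i j| <= K) ->
  `|Q p X Y| <= (A0 + 2 * A1 + A2) * K ^+ 2.
Proof.
move=> K0 h0 h1 h2 XK YK.
have qXX := ads_form_bound K0 K0 XK XK.
have qXY := ads_form_bound K0 K0 XK YK.
have qYY := ads_form_bound K0 K0 YK YK.
have pr (a A q : R) : `|a| <= A -> `|q| <= 2 * (K * K) -> `|a * q| <= A * (2 * (K * K)).
  by move=> aA qK; rewrite normrM ler_pM.
rewrite /Q /half_quadratic normrM ger0_norm ?invr_ge0// mulrC ler_pdivrMr//.
apply: (le_trans (ler_normD _ _)).
rewrite (_ : _ * 2 = A0 * (2 * (K * K)) + 2 * (A1 * (2 * (K * K))) +
  A2 * (2 * (K * K))); last by ring.
apply: lerD; last exact: pr.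
apply: (le_trans (ler_normD _ _)); apply: lerD; first exact: pr.
by rewrite normrM ger0_norm// ler_pM2l//; exact: pr.
Qed.

(** Pointwise, the change of density is a divergence, minus the pairing of [G t] with the tension,
    plus the quadratic form of the derivatives of [G t]. The divergence integrates to zero since
    [G t] vanishes on [Omega] off [C], and the quadratic term is [O(t^2)] by the Lipschitz
    bounds. *)
Lemma first_variation_formula : exists2 M : R, 0 <= M &
  forall t, `|t| <= eps / 2 ->
  `|energy h C (fun p => F (t, p)) - energy h C nu +
    \int[mu2]_(p in C) ads_form (G t p) (tension p)| <= M * t ^+ 2.
Proof.
have oO := Omega_open.
have [K0 K00 FK0] := variation_pd_lipschitz ex.
have [K1 K10 FK1] := variation_pd_lipschitz ey.
have [A0 A00 aA0] := continuous_bounded_on cC CO a00_cont.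
have [A1 A10 aA1] := continuous_bounded_on cC CO a01_cont.
have [A2 A20 aA2] := continuous_bounded_on cC CO a11_cont.
(* The sum [K0 + K1] serves as one Lipschitz constant for both derivatives; the factor 2 in
   [ads_form_bound] absorbs the one half of the quadratic form. *)
pose B := (A0 + 2 * A1 + A2) * (K0 + K1) ^+ 2.
have B0 : 0 <= B by rewrite /B mulr_ge0 ?sqr_ge0// !addr_ge0// mulr_ge0.
exists (B * fine (mu2 C)); first by rewrite mulr_ge0// fine_ge0.
move=> t te; have te' := half_lt te.
have cFt := slice_smooth 1 te'.
have cG : Ck_on 1 Omega (G t) := Ck_on_submx oO cFt (nu_smooth 1).
have cY0 : Ck_on 1 Omega (fun p => ads_form (G t p) (V0 p)) := Ck_on_ads oO cG V0_C1.
have cY1 : Ck_on 1 Omega (fun p => ads_form (G t p) (V1 p)) := Ck_on_ads oO cG V1_C1.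
have Y0 X p : Omega p -> ~ C p -> ads_form (G t p) X = 0.
  move=> Op nCp; case: F_var => _ _ _ Fnu; rewrite /G Fnu// subrr.
  by rewrite ads_formE !mxE; ring.
have icY0 := continuous_integrable (Ck_on_pd ex cY0).
have icY1 := continuous_integrable (Ck_on_pd ey cY1).
have iGE := continuous_integrable (Ck_on_ads oO (Ck_onW cG) Ck_on_tension).
have iF := continuous_integrable (Ck_on_energy_density cFt).
have inu := continuous_integrable (Ck_on_energy_density (nu_smooth 1)).
have iFnu := continuous_integrable
  (Ck_on_sub oO (Ck_on_energy_density cFt) (Ck_on_energy_density (nu_smooth 1))).
have idiv := continuous_integrable (Ck_on_add oO (Ck_on_pd ex cY0) (Ck_on_pd ey cY1)).
have irem := continuous_integrable (Ck_on_Q (Ck_on_pd ex cG) (Ck_on_pd ey cG)).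
have int_div : \int[mu2]_(p in C) divergence (G t) p = 0.
  rewrite (Rintegral2D cC icY0 icY1).
  rewrite -[RHS]addr0; congr (_ + _).
    rewrite -(Rintegral_partial_eq0 0 oO cC CO cY0 (fun p => @Y0 _ p)).
    by apply: eq_Rintegral => p _; rewrite pd_ex.
  rewrite -(Rintegral_partial_eq0 1 oO cC CO cY1 (fun p => @Y0 _ p)).
  by apply: eq_Rintegral => p _; rewrite pd_ey.
have -> : energy h C (fun p => F (t, p)) - energy h C nu +
    \int[mu2]_(p in C) ads_form (G t p) (tension p) = \int[mu2]_(p in C) rem (G t) p.
  rewrite /energy -(Rintegral2B cC iF inu) -(Rintegral2D cC iFnu iGE).
  rewrite -[RHS]add0r -int_div -(Rintegral2D cC idiv irem).
  apply: eq_Rintegral => p; rewrite inE => /CO Op.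
  by rewrite (energy_density_diff cFt Op) addrAC subrK.
have -> : B * fine (mu2 C) * t ^+ 2 = (B * t ^+ 2) * fine (mu2 C) by rewrite mulrAC.
apply: (Rintegral2_bound cC irem) => p Cp.
rewrite /B -mulrA -[t ^+ 2]real_normK ?num_real// -exprMn.
apply: Q_bound; [|exact: aA0|exact: aA1|exact: aA2| |].
- by rewrite mulr_ge0// addr_ge0.
- by move=> i j; apply: (le_trans (FK0 t p te Cp i j)); rewrite ler_wpM2r// lerDl.
- by move=> i j; apply: (le_trans (FK1 t p te Cp i j)); rewrite ler_wpM2r// lerDr.
Qed.

End first_variation.

(** * A smooth bump function *)

Section flat_function.
Context {R : realType}.

(** The powers of [1 / s] are included so that the derivative of each member is a linear combination
    of members, which makes smoothness an induction. *)
Definition flat (k : nat) (s : R) : R :=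
  if 0 < s then s^-1 ^+ k * expR (- s^-1) else 0.

Lemma flat_le0 k s : s <= 0 -> flat k s = 0.
Proof. by rewrite /flat leNgt => /negbTE ->. Qed.

Lemma flat_gt0 k s : 0 < s -> 0 < flat k s.
Proof. by move=> s0; rewrite /flat s0 mulr_gt0 ?expR_gt0// exprn_gt0// invr_gt0. Qed.

Lemma flat_ge0 k s : 0 <= flat k s.
Proof.
by have [s0|/(flat_le0 k) -> //] := ltP 0 s; exact/ltW/flat_gt0.
Qed.

(** With [x = 1 / s], the exponential series gives [exp x >= x^(k+2) / (k+2)!]. A quadratic bound is
    what [quadratic_is_derive] needs to differentiate at the origin. *)
Lemma flat_quadratic k : exists2 M : R, 0 <= M & forall s, `|flat k s| <= M * s ^+ 2.
Proof.
exists (k.+2`!%:R) => // s; rewrite ger0_norm ?flat_ge0//.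
have [s0|s0] := ltP 0 s; last by rewrite flat_le0// mulr_ge0 ?sqr_ge0.
rewrite /flat s0 -ler_pdivrMr ?exprn_gt0//.
have si0 : 0 <= s^-1 by rewrite invr_ge0 ltW.
rewrite mulrAC -(exprVn s 2) -exprD addn2 expRN ler_pdivrMr ?expR_gt0//.
rewrite mulrC -ler_pdivrMr ?ltr0n ?fact_gt0//.
by apply: le_trans (expR_ge1Dxn k.+1 si0); rewrite lerDr.
Qed.

Lemma flat_is_derive k s :
  is_derive s (1 : R) (flat k) (- k%:R * flat k.+1 s + flat k.+2 s).
Proof.
have [s0|s0|->] := ltgtP s 0.
- have -> : - k%:R * flat k.+1 s + flat k.+2 s = 0.
    by rewrite !(flat_le0 _ (ltW s0)) mulr0 addr0.
  apply: (@near_eq_is_derive _ _ _ (cst 0)).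
  by near=> t; rewrite flat_le0//; apply/ltW; near: t; exact: lt_nbhsl.
- pose g (t : R) := t^-1 ^+ k * expR (- t^-1).
  apply: (@near_eq_is_derive _ _ _ g).
    by near=> t; rewrite /flat ifT//; near: t; exact: lt_nbhsr.
  have s0' : s != 0 by rewrite gt_eqF.
  have dV : is_derive s (1 : R) (fun t : R => t^-1) (- s ^- 2).
    split; first exact: derivableV.
    by rewrite deriveV// derive_id /GRing.scale/= mulr1.
  have dX := is_deriveX k dV.
  have dE := @is_derive1_comp _ expR (fun t : R => - t^-1) s _ _
    (is_derive_expR (- s^-1)) (is_deriveN dV).
  have gE : g = (GRing.inv : R -> R) ^+ k * (fun t => expR (- t^-1)).
    by apply/funext => t; rewrite /g [in RHS]exprfctE.
  rewrite gE; apply: (is_derive_eq (is_deriveM dX dE)).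
  rewrite /flat s0 /GRing.scale/= !exprfctE/= !exprS; case: k {dX g gE} => [|k].
    by rewrite !expr0; field.
  rewrite /= expr0 mulr1 exprS.
  by move: (s^-1 ^+ k) (expR _) (k.+1%:R : R) => e x m; field.
- have [M M0 flatM] := flat_quadratic k.
  rewrite !flat_le0// mulr0 addr0.
  apply: (@quadratic_is_derive _ _ _ M 1) => // t _.
  by rewrite (flat_le0 k (lexx 0)) mulr0 !subr0.
Unshelve. all: by end_near. Qed.

Lemma Ck_on_flat n k : Ck_on n setT (flat k).
Proof.
have dflat m s : differentiable (flat m) s.
  by apply/derivable1_diffP; case: (flat_is_derive m s).
elim: n k => [|n IH] k; first by move=> s _; exact: differentiable_continuous.
split=> [s _|v]; first exact: dflat.
apply: (@Ck_on_eq _ _ _ _ _ (fun s => v * (- k%:R * flat k.+1 s + flat k.+2 s))).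
- exact: openT.
- move=> s _; rewrite (derive_real_dir v (dflat k s)).
  by case: (flat_is_derive k s) => _ ->.
apply: (Ck_on_mul openT); first exact: Ck_on_cst.
apply: (Ck_on_add openT) => //.
by apply: (Ck_on_mul openT) => //; exact: Ck_on_cst.
Qed.

End flat_function.

Section plane_bump.
Context {R : realType}.
Implicit Types (c p : R * R) (r : R).

Notation mu2 := ((@lebesgue_measure R) \x (@lebesgue_measure R))%E.

Definition square c r : set (R * R) :=
  `[c.1 - r, c.1 + r] `*` `[c.2 - r, c.2 + r].

Definition plane_bump c r p : R :=
  flat 0 (r ^+ 2 - (p.1 - c.1) ^+ 2) * flat 0 (r ^+ 2 - (p.2 - c.2) ^+ 2).

Lemma compact_square c r : compact (square c r).
Proof. by apply: compact_setX; exact: segment_compact. Qed.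

Lemma squareP c r p : square c r p <-> `|p.1 - c.1| <= r /\ `|p.2 - c.2| <= r.
Proof. by rewrite /square /= !in_itv/= -!ler_distl. Qed.

Lemma nbhs_square c (A : set (R * R)) : nbhs c A ->
  exists2 r : R, 0 < r & square c r `<=` A.
Proof.
case: c => x y [[B1 B2] /= [[r1 /= r10 rB1] [r2 /= r20 rB2]] B12].
exists (Num.min r1 r2 / 2); first by rewrite divr_gt0// lt_min r10.
have m0 : 0 < Num.min r1 r2 by rewrite lt_min r10.
have [h1 h2] : Num.min r1 r2 / 2 < r1 /\ Num.min r1 r2 / 2 < r2.
  by apply/andP; rewrite -lt_min gtr_pMr// invf_lt1// ltr1n.
move=> [u v] /squareP/= [xu yv]; apply: (B12 (u, v)); split => /=.
  by apply: rB1 => /=; rewrite distrC (le_lt_trans xu).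
by apply: rB2 => /=; rewrite distrC (le_lt_trans yv).
Qed.

Lemma square_nbhs c r : 0 < r -> nbhs c (square c r).
Proof.
move=> r0; exists (ball c.1 r, ball c.2 r) => /=.
  by split; exact: nbhsx_ballx.
move=> p [/= p1 p2]; apply/squareP; split; rewrite distrC; exact: ltW.
Qed.

Lemma Ck_on_plane_bump n c r : Ck_on n setT (plane_bump c r).
Proof.
have oT : open [set: R * R] := openT.
have cp (f : R * R -> R) (a : R) : Ck_on n setT f ->
    Ck_on n setT (fun p => flat 0 (r ^+ 2 - (f p - a) ^+ 2)).
  move=> cf; apply: (@Ck_on_comp _ _ _ _ setT (flat 0)
    (fun p => r ^+ 2 - (f p - a) ^+ 2)) => //; first exact: openT.
    exact: Ck_on_flat.
  have cfa : Ck_on n setT (fun p => f p - a) := Ck_on_sub oT cf (Ck_on_cst _ _ _).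
  exact: (Ck_on_sub oT (Ck_on_cst _ _ _) (Ck_on_mul oT cfa cfa)).
apply: (Ck_on_mul oT); apply: cp.
  apply: (@Ck_on_linear _ _ _ _ _ fst) => q; exact: cvg_fst.
apply: (@Ck_on_linear _ _ _ _ _ snd) => q; exact: cvg_snd.
Qed.

Lemma plane_bump_ge0 c r p : 0 <= plane_bump c r p.
Proof. by rewrite mulr_ge0// flat_ge0. Qed.

Lemma plane_bump_center_gt0 c r : 0 < r -> 0 < plane_bump c r c.
Proof.
by move=> r0; rewrite /plane_bump !subrr expr0n subr0 mulr_gt0// flat_gt0// exprn_gt0.
Qed.

Lemma plane_bump_out c r p : 0 < r -> ~ square c r p -> plane_bump c r p = 0.
Proof.
move=> r0 np; have far a : r < `|a| -> flat 0 (r ^+ 2 - a ^+ 2) = 0.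
  move=> ra; rewrite flat_le0// subr_le0 -[a ^+ 2]real_normK ?num_real//.
  by apply: lerXn2r; rewrite ?nnegrE ?normr_ge0 //; exact: ltW.
rewrite /plane_bump; have [p1|/far -> ] := leP `|p.1 - c.1| r; last by rewrite mul0r.
have [p2|/far -> ] := leP `|p.2 - c.2| r; last by rewrite mulr0.
by case: np; apply/squareP.
Qed.

(** By continuity [u] exceeds [u c / 2] on a small square around [c]; the integral is compared with
    that of this constant on the square, which has positive measure. *)
Lemma Rintegral_gt0 (Omega C : set (R * R)) (u : R * R -> R) c :
  open Omega -> compact C -> C `<=` Omega -> Ck_on 0 Omega u ->
  nbhs c C -> (forall p, C p -> 0 <= u p) -> 0 < u c ->
  0 < \int[mu2]_(p in C) u p.
Proof.
move=> oO cC CO cu nC u0 uc; have Oc : Omega c := CO _ (nbhs_singleton nC).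
have cuc : u p @[p --> c] --> u c := cu c Oc.
have nu : nbhs c [set p | u c / 2 < u p].
  by apply: (cvgr_gt _ cuc); rewrite gtr_pMr// invf_lt1// ltr1n.
have [r r0 rA] := nbhs_square (filterI nC nu).
have cS : compact (square c r) by exact: compact_square.
have mC := compact_measurable2 cC; have mS := compact_measurable2 cS.
have iu : mu2.-integrable C (EFin \o u) := continuous_integrable2 oO cC CO cu.
have iS : mu2.-integrable (square c r) (EFin \o cst (u c / 2)).
  by apply: (continuous_integrable2 openT cS (@subsetT _ _)) => p _; exact: cvg_cst.
have SC : square c r `<=` C by move=> p /rA[].
have icst : mu2.-integrable C (EFin \o (cst (u c / 2) \_ (square c r))).
  rewrite -restrict_EFin; apply/(@integrable_restrict _ _ _ mu2 _ mS C mC).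
  by rewrite setIidr.
have le := @le_Rintegral _ _ _ mu2 C _ _ mC icst iu _.
apply: (lt_le_trans _ (le _)) => {le} [|p Cp]; last first.
  rewrite patchE; case: ifPn => [|_]; last exact: u0.
  by rewrite inE => /rA[_ /ltW].
rewrite -(@Rintegral_mkcondr _ _ _ mu2 C (square c r)) setIidr//.
rewrite (@Rintegral_cst _ _ _ mu2 _ mS) mulr_gt0 ?divr_gt0//.
have itv_gt0 (a : R) : (0 < (@lebesgue_measure R) [set` `[(a - r)%R, (a + r)%R]%R])%E.
  rewrite lebesgue_measure_itv/= lte_fin ifT; last by lra.
  by rewrite -EFinB lte_fin; lra.
have E : mu2 (square c r) = ((@lebesgue_measure R) [set` `[(c.1 - r)%R, (c.1 + r)%R]%R] *
    (@lebesgue_measure R) [set` `[(c.2 - r)%R, (c.2 + r)%R]%R])%E.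
  by apply: product_measure1E; exact: measurable_itv.
have pos : (0 < mu2 (square c r))%E by rewrite E; exact: mule_gt0.
by apply: fine_gt0; apply/andP; split; [exact: pos|exact: compact_finite_measure2].
Qed.

End plane_bump.

(** * Surfaces of positive extrinsic curvature *)

Section mbar_algebra.
Context {R : realType}.
Implicit Types X Y : 'M[R]_2.

Lemma mbarM X Y : mbar (X *m Y) = mbar Y *m mbar X.
Proof. by apply: matrix2P; rewrite mulmx2E !mbarE !mulmx2E /=; ring. Qed.

Lemma mbar_tr0 X : \tr X = 0 -> mbar X = - X.
Proof. by move=> X0; rewrite /mbar X0 raddf0 sub0r. Qed.

Lemma ads_form1 X : ads_form X 1%:M = - (2^-1 * \tr X).
Proof. by rewrite ads_formE mxtrace2E !mxE/=; ring. Qed.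

Lemma ads_form1_eq0 X : ads_form X 1%:M = 0 -> \tr X = 0.
Proof.
by rewrite ads_form1 => /eqP; rewrite oppr_eq0 mulf_eq0 invr_eq0 pnatr_eq0 => /eqP.
Qed.

End mbar_algebra.

Section matrix_identities.
Context {R : realType}.
Implicit Types (X Y Z W P : 'M[R]_2) (k : R).

Lemma flux_identity r A B k l X Y Z W : k *: X - l *: Y = A *: Z - B *: W ->
  (B * r) *: W - (A * r) *: Z = - (r * k) *: X + (r * l) *: Y.
Proof.
move=> E; apply/matrixP => i j.
by have := congr1 (fun M : 'M[R]_2 => (r *: M) i j) E; rewrite !mxE; lra.
Qed.

(** Here [P] and [P'] stand for the x-derivative of [nu a_y] and the y-derivative of [nu a_x], and
    [M] for the mixed derivative of [nu]. [M] cancels between the two shape terms, and [P] and [P']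
    differ by a normal vector. *)
Lemma tension_identity (cx cy c d m : R) (n b0 b1 s0 s1 P P' M : 'M[R]_2) :
  P = P' - m *: n ->
  (cx *: b1 + c *: P) - (- (d ^+ 2 * cx) *: s1 + d *: (P - M)) +
  ((- (d ^+ 2 * cy) *: s0 + d *: (P' - M)) - (cy *: b0 + c *: P')) =
  ((d - c) * m) *: n + (cx *: (b1 + d ^+ 2 *: s1) - cy *: (b0 + d ^+ 2 *: s0)).
Proof. by move=> ->; apply/matrixP => i j; rewrite !mxE; ring. Qed.

(** The structure equations: [Z] is the common term [f^-1 f_xy] in the derivatives of [a]. It
    cancels together with the products of [n] with two factors [a], and only products of [s] with
    [a] survive. *)
Lemma integrability_identity (n a0 a1 s0 s1 n0 n1 a10 a01 Z M : 'M[R]_2) :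
  n0 = n *m a0 - s0 -> n1 = n *m a1 - s1 ->
  a10 = - (a0 *m a1) + Z -> a01 = - (a1 *m a0) + Z ->
  s0 *m a1 - s1 *m a0 = M ->
  n0 *m a1 + n *m a10 = n1 *m a0 + n *m a01 - M.
Proof.
move=> -> -> -> -> <-; rewrite !mulmxBl !mulmxDr !mulmxN !mulmxA.
move: (n *m a0 *m a1) (n *m a1 *m a0) (s0 *m a1) (s1 *m a0) (n *m Z) => x y z t u.
by apply/matrixP => i j; rewrite !mxE; ring.
Qed.

(** The inverse of [h] is its cofactor matrix over [- s ^ 2], negative because [h] is Lorentzian;
    multiplied by the area density [s] it leaves [- 1 / s] times cofactors. *)
Lemma energy_trace (h g : 'M[R]_2) (s h00 h01 h11 x y z : R) :
  s != 0 -> \det h = - s ^+ 2 ->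
  h 0 0 = h00 -> h 0 1 = h01 -> h 1 0 = h01 -> h 1 1 = h11 ->
  g 0 0 = x -> g 0 1 = y -> g 1 0 = y -> g 1 1 = z ->
  2^-1 * \tr (invmx h *m g) * s =
  2^-1 * (- (s^-1 * h11) * x + 2 * (s^-1 * h01 * y) + - (s^-1 * h00) * z).
Proof.
move=> s0 dh e00 e01 e10 e11 g00 g01 g10 g11.
have dh0 : \det h != 0 by rewrite dh oppr_eq0 sqrf_eq0.
rewrite (invmx_mbar dh0) -scalemxAl mxtraceZ dh mxtrace2E !mulmx2E !mbarE.
by rewrite e00 e01 e10 e11 g00 g01 g10 g11 /=; field.
Qed.

End matrix_identities.

Lemma fundI_pd (R : realType) (F : R * R -> 'M[R]_2) p :
  [/\ fundI F p 0 0 = ads_form (pd (ex R) F p) (pd (ex R) F p),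
      fundI F p 0 1 = ads_form (pd (ex R) F p) (pd (ey R) F p),
      fundI F p 1 0 = ads_form (pd (ex R) F p) (pd (ey R) F p) &
      fundI F p 1 1 = ads_form (pd (ey R) F p) (pd (ey R) F p)].
Proof.
split; rewrite mxE; [rewrite pd_ex|rewrite pd_ex pd_ey|rewrite pd_ex pd_ey|rewrite pd_ey].
- exact: erefl.
- exact: erefl.
- exact: ads_formC.
- exact: erefl.
Qed.

(** * Moving frame of the surface, its fundamental forms and signed areas *)

Section surface.
Context {R : realType}.
Variables (Omega : set (R * R)) (f N : R * R -> 'M[R]_2).
Hypothesis Omega_open : open Omega.
Hypothesis f_timelike : timelike_immersion Omega f.
Hypothesis N_normal : unit_normal Omega f N.
Hypothesis K_ext_pos : forall p, Omega p -> 0 < extrinsic_curvature f N p.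
Hypothesis nu_immersion : immersion_on Omega (gauss_map f N).
Notation ex := (@ex R).
Notation ey := (@ey R).
Notation nu := (gauss_map f N).
Notation q := (@ads_form R).

Let f_smooth n : Ck_on n Omega f. Proof. by case: f_timelike => -[+ _] _ _; apply. Qed.
Let N_smooth n : Ck_on n Omega N. Proof. by case: N_normal => + _; apply. Qed.
Let nu_smooth n : Ck_on n Omega nu. Proof. by case: nu_immersion => + _; apply. Qed.

Let det_f p : Omega p -> \det (f p) = 1.
Proof.
case: f_timelike => _ fA _ /fA; rewrite /AdS3 /= ads_form_det => /eqP.
by rewrite eqr_opp => /eqP.
Qed.

Let f_mbar p : Omega p -> f p *m mbar (f p) = 1%:M.
Proof. by move=> Op; rewrite mul_mbar det_f. Qed.

Let NE p : Omega p -> N p = f p *m nu p.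
Proof.
move=> Op; rewrite /gauss_map invmx_mbar det_f ?oner_eq0//.
by rewrite invr1 scale1r mulmxA f_mbar// mul1mx.
Qed.

Let q_f p X Y : Omega p -> q (f p *m X) (f p *m Y) = q X Y.
Proof. by move=> Op; rewrite ads_form_mull det_f// mul1r. Qed.

Lemma gauss_map_dS2 p : Omega p -> dS2 (nu p).
Proof.
move=> Op; case: N_normal => _ /(_ p Op)[NN Nf _].
split; last by rewrite -(q_f _ _ Op) -NE.
apply: ads_form1_eq0; rewrite -(q_f _ _ Op) -NE// mulmx1; exact: Nf.
Qed.

(* [mbar (f p)] is the inverse of [f p], so [mc_form] is the Maurer-Cartan form
   [f^-1 df]; [shape v] is the shape operator read in the Lie algebra, with
   [pd v N = - f *m shape v]. *)
Definition mc_form v p : 'M[R]_2 := mbar (f p) *m pd v f p.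

Definition shape v p : 'M[R]_2 := nu p *m mc_form v p - pd v nu p.

Lemma mc_formE v p : Omega p -> pd v f p = f p *m mc_form v p.
Proof. by move=> Op; rewrite /mc_form mulmxA f_mbar// mul1mx. Qed.

Lemma gauss_map_derive v p : pd v nu p = nu p *m mc_form v p - shape v p.
Proof. by rewrite /shape subKr. Qed.

Lemma Ck_on_mc_form n v : Ck_on n Omega (mc_form v).
Proof.
exact: (Ck_on_mulmx Omega_open (Ck_on_mbar Omega_open (f_smooth n))
  (Ck_on_pd v (f_smooth n.+1))).
Qed.

Lemma Ck_on_shape n v : Ck_on n Omega (shape v).
Proof.
exact: (Ck_on_submx Omega_open (Ck_on_mulmx Omega_open (nu_smooth n)
  (Ck_on_mc_form n v)) (Ck_on_pd v (nu_smooth n.+1))).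
Qed.

Let pd_const (W : normedModType R) v (u : R * R -> W) w p : Omega p ->
  (forall x, Omega x -> u x = w) -> pd v u p = 0.
Proof.
move=> Op uw; rewrite (pd_eq_on v Omega_open Op uw); exact: pd_cst.
Qed.

Lemma mc_form_tr0 v p : Omega p -> \tr (mc_form v p) = 0.
Proof.
move=> Op; have df := (f_smooth 1).1 p Op.
have H : pd v (fun x => q (f x) (f x)) p = 0.
  apply: (@pd_const R v (fun x => q (f x) (f x)) (-1) p Op) => x Ox.
  by case: f_timelike => _ /(_ x Ox).
move: H; rewrite (pd_ads v df df) (ads_formC (pd v f p)) mc_formE// => H.
apply: ads_form1_eq0; rewrite ads_formC -(q_f _ _ Op) mulmx1; move: H.
by move: (q _ _) => x; lra.
Qed.

Lemma gauss_map_derive_tangent v p : Omega p -> tangent (nu p) (pd v nu p).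
Proof.
move=> Op; have dnu := (nu_smooth 1).1 p Op; split.
  have H : pd v (fun x => q (nu x) 1%:M) p = 0.
    apply: (@pd_const R v (fun x => q (nu x) 1%:M) 0 p Op) => x Ox.
    by rewrite ads_form1; case: (gauss_map_dS2 Ox) => -> _; rewrite mulr0 oppr0.
  apply: ads_form1_eq0; move: H; rewrite (pd_ads v dnu (differentiable_cst _ _)).
  rewrite pd_cst => <-; rewrite [X in _ + X](_ : _ = 0) ?addr0//.
  by rewrite ads_formE !mxE; ring.
have H : pd v (fun x => q (nu x) (nu x)) p = 0.
  apply: (@pd_const R v (fun x => q (nu x) (nu x)) 1 p Op) => x Ox.
  by case: (gauss_map_dS2 Ox).
move: H; rewrite (pd_ads v dnu dnu) (ads_formC (nu p)).
by move: (q _ _) => x; lra.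
Qed.

Let q_pdf_N i p : Omega p -> q (N p) (partial i f p) = 0.
Proof. by move=> Op; case: N_normal => _ /(_ p Op)[_ _]; apply. Qed.

Let q_pdf_Nx p : Omega p -> q (N p) (pd ex f p) = 0.
Proof. by move=> Op; rewrite -pd_ex q_pdf_N. Qed.

Let q_pdf_Ny p : Omega p -> q (N p) (pd ey f p) = 0.
Proof. by move=> Op; rewrite -pd_ey q_pdf_N. Qed.

Let mc_form_tangent v p : Omega p -> q (N p) (pd v f p) = 0 ->
  tangent (nu p) (mc_form v p).
Proof.
move=> Op NV; split; first exact: mc_form_tr0.
by rewrite -(q_f _ _ Op) -mc_formE// -NE// ads_formC.
Qed.

Let shape_tangent v p : Omega p -> tangent (nu p) (mc_form v p) ->
  tangent (nu p) (shape v p).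
Proof.
move=> Op Ta; apply: tangentB; last exact: gauss_map_derive_tangent.
exact: (tangentJ Ta).
Qed.

Let N_derive v p : Omega p -> tangent (nu p) (mc_form v p) ->
  pd v N p = - (f p *m shape v p).
Proof.
move=> Op Ta; have df := (f_smooth 1).1 p Op; have dnu := (nu_smooth 1).1 p Op.
rewrite (pd_eq_on v Omega_open Op NE) (pd_mulmx v df dnu) mc_formE//.
rewrite -mulmxA (tangent_anticomm (gauss_map_dS2 Op) Ta) -mulmxDr /shape.
by rewrite -[RHS]mulmxN opprB addrC.
Qed.

(** Differentiating [<N, f_v> = 0] in the direction [w] moves the derivative to [N], where it is
    [- f s]; left multiplication by [f] is an isometry. *)
Let second_form_shape v w p : Omega p -> tangent (nu p) (mc_form w p) ->
  (forall x, Omega x -> q (N x) (pd v f x) = 0) ->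
  q (pd w (pd v f) p) (N p) = q (mc_form v p) (shape w p).
Proof.
move=> Op Tw Nv; have dN := (N_smooth 1).1 p Op.
have dfv := (Ck_on_pd v (f_smooth 2)).1 p Op.
have := @pd_const R w (fun x => q (N x) (pd v f x)) 0 p Op Nv.
rewrite (pd_ads w dN dfv) N_derive// mc_formE//.
rewrite ads_formNl q_f// (ads_formC (shape w p)) (ads_formC (N p)) => /eqP.
by rewrite addrC subr_eq0 => /eqP.
Qed.

Section at_a_point.
Variables (p : R * R) (Op : Omega p).
Notation n := (nu p).
Notation a0 := (mc_form ex p).
Notation a1 := (mc_form ey p).
Notation s0 := (shape ex p).
Notation s1 := (shape ey p).

Lemma tangent_mc_x : tangent n a0. Proof. exact: (mc_form_tangent Op (q_pdf_Nx Op)). Qed.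
Lemma tangent_mc_y : tangent n a1. Proof. exact: (mc_form_tangent Op (q_pdf_Ny Op)). Qed.
Lemma tangent_shape_x : tangent n s0. Proof. exact: (shape_tangent Op tangent_mc_x). Qed.
Lemma tangent_shape_y : tangent n s1. Proof. exact: (shape_tangent Op tangent_mc_y). Qed.

Lemma fundIIE : [/\ fundII f N p 0 0 = q a0 s0, fundII f N p 0 1 = q a0 s1,
  fundII f N p 1 0 = q a1 s0 & fundII f N p 1 1 = q a1 s1].
Proof.
have Ex : partial 0 f = pd ex f by apply/funext => x; exact: pd_ex.
have Ey : partial 1 f = pd ey f by apply/funext => x; exact: pd_ey.
split; rewrite mxE.
- by rewrite Ex pd_ex; exact: (second_form_shape Op tangent_mc_x q_pdf_Nx).
- by rewrite Ex pd_ey; exact: (second_form_shape Op tangent_mc_y q_pdf_Nx).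
- by rewrite Ey pd_ex; exact: (second_form_shape Op tangent_mc_x q_pdf_Ny).
- by rewrite Ey pd_ey; exact: (second_form_shape Op tangent_mc_y q_pdf_Ny).
Qed.

Lemma shape_sym : q a0 s1 = q a1 s0.
Proof.
rewrite -(second_form_shape Op tangent_mc_y q_pdf_Nx) -(second_form_shape Op tangent_mc_x q_pdf_Ny).
by rewrite (pdC ex ey Omega_open (f_smooth 2) Op).
Qed.

Lemma fundIE : [/\ fundI f p 0 0 = q a0 a0, fundI f p 0 1 = q a0 a1,
  fundI f p 1 0 = q a1 a0 & fundI f p 1 1 = q a1 a1].
Proof. by split; rewrite mxE ?pd_ex ?pd_ey !mc_formE// q_f. Qed.

(** These two are the signed area densities of the first and third fundamental forms. Their quotient
    is the extrinsic curvature, so its positivity says that they have the same sign. *)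
Definition area_I x := area_form (nu x) (mc_form ex x) (mc_form ey x).
Definition area_III x := area_form (nu x) (shape ex x) (shape ey x).

Lemma det_fundI : \det (fundI f p) = - area_I p ^+ 2.
Proof.
case: fundIE => e00 e01 e10 e11; rewrite det_mx2 e00 e01 e10 e11.
by rewrite (det_gram (gauss_map_dS2 Op) tangent_mc_x tangent_mc_y tangent_mc_x tangent_mc_y) expr2.
Qed.

Lemma det_fundII : \det (fundII f N p) = - (area_I p * area_III p).
Proof.
case: fundIIE => e00 e01 e10 e11; rewrite det_mx2 e00 e01 e10 e11.
exact: (det_gram (gauss_map_dS2 Op) tangent_mc_x tangent_mc_y tangent_shape_x tangent_shape_y).
Qed.

Lemma area_I_neq0 : area_I p != 0.
Proof.
case: f_timelike => _ _ /(_ p Op)[P _ PGP].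
apply/eqP => A0; have := congr1 determinant PGP.
rewrite !det_mulmx det_fundI A0 expr0n oppr0 mulr0 mul0r det_diag.
rewrite (bigD1 0)//= (bigD1 1)//= big1; last first.
  by apply: ord2_ind => //=.
rewrite !mxE/= => /eqP; rewrite eq_sym !mulf_eq0 oppr_eq0 !oner_eq0.
by [].
Qed.

Lemma extrinsic_curvatureE : extrinsic_curvature f N p = area_III p / area_I p.
Proof.
rewrite /extrinsic_curvature det_fundI det_fundII.
by have A0 := area_I_neq0; field.
Qed.

Lemma area_mul_gt0 : 0 < area_I p * area_III p.
Proof.
have := K_ext_pos Op; rewrite extrinsic_curvatureE.
have A2 : 0 < area_I p ^+ 2 by rewrite exprn_even_gt0//= area_I_neq0.
move=> /(mulr_gt0 A2); congr (0 < _).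
by have A0 := area_I_neq0; field.
Qed.

Lemma area_III_neq0 : area_III p != 0.
Proof. by have := lt0r_neq0 area_mul_gt0; rewrite mulf_eq0 negb_or => /andP[]. Qed.

(** The difference is the area of the pair of derivatives of [nu]. If it vanished, [gram_cofactor]
    would be a linear relation between them, trivial as [nu] is an immersion; so the x-derivative
    would be orthogonal to the tangent plane, hence zero. Since the difference is [K] times
    [area_I], this means that [K] does not vanish. *)
Lemma area_gauss_neq0 : area_III p - area_I p != 0.
Proof.
have nS := gauss_map_dS2 Op; have dnu := (nu_smooth 1).1 p Op.
have Tx := gauss_map_derive_tangent ex Op; have Ty := gauss_map_derive_tangent ey Op.
have E : area_form n (pd ex nu p) (pd ey nu p) = area_III p - area_I p.
  rewrite (gauss_map_derive ex p) (gauss_map_derive ey p).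
  exact: (area_gauss nS tangent_mc_x tangent_mc_y tangent_shape_x tangent_shape_y shape_sym).
rewrite -E.
have [_ inj] := nu_immersion.
have dnuE (u v : R) : 'd nu p (u, v) = u *: pd ex nu p + v *: pd ey nu p.
  rewrite -pd_ex -pd_ey /partial /axis/= !deriveE// -!linearZ -linearD/=.
  by congr ('d _ _ _); congr (_, _); rewrite /= /GRing.scale/= ?mulr1 ?mulr0 ?addr0 ?add0r.
have indep (u v : R) : u *: pd ex nu p + v *: pd ey nu p = 0 -> u = 0 /\ v = 0.
  by rewrite -dnuE -(linear0 ('d nu p)) => /(inj p Op)[-> ->].
apply/eqP => w0.
have qZ Z : tangent (nu p) Z -> q Z (pd ex nu p) = 0.
  move=> TZ; have := gram_cofactor nS Tx Ty TZ; rewrite w0 scale0r -scaleNr.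
  by move=> /indep[_ /eqP]; rewrite oppr_eq0 => /eqP.
have nux0 : pd ex nu p = 0.
  exact: (tangent_nondegenerate nS tangent_mc_x tangent_mc_y Tx area_I_neq0
    (qZ _ tangent_mc_x) (qZ _ tangent_mc_y)).
have [|/eqP] := indep 1 0; first by rewrite nux0 scaler0 scale0r addr0.
by rewrite oner_eq0.
Qed.

End at_a_point.

(** * Energy fluxes and their divergence *)

Let Ck_on_area_I n : Ck_on n Omega area_I.
Proof.
exact: (Ck_on_ads Omega_open (Ck_on_mulmx Omega_open (Ck_on_mc_form n ex)
  (Ck_on_mc_form n ey)) (nu_smooth n)).
Qed.

Let Ck_on_area_III n : Ck_on n Omega area_III.
Proof.
exact: (Ck_on_ads Omega_open (Ck_on_mulmx Omega_open (Ck_on_shape n ex)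
  (Ck_on_shape n ey)) (nu_smooth n)).
Qed.

(** By [det_fundII] this is the inverse of the area density of the second fundamental form. *)
Definition inv_sqrt_area p : R := (Num.sqrt (area_I p * area_III p))^-1.
Notation r := inv_sqrt_area.

(** One derivative is enough, because the tension differentiates the fluxes once. The derivative of
    [g] is [- g ^ 3 / 2], so its continuity follows from that of [g]. *)
Lemma Ck_on_inv_sqrt_area : Ck_on 1 Omega r.
Proof.
pose g (x : R) : R := (Num.sqrt x)^-1.
have dg (x : R) : 0 < x -> is_derive x (1 : R) g (- (2^-1 * g x ^+ 3)).
  move=> x0; have s0 : Num.sqrt x != 0 by rewrite gt_eqF// sqrtr_gt0.
  have ds := is_derive1_sqrt x0.
  split; first exact: derivableV.
  rewrite deriveV// derive_val /g /GRing.scale/=.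
  by field.
have dfg (x : R) : 0 < x -> differentiable g x.
  by move=> /dg[? _]; exact/derivable1_diffP.
have op : open [set x : R | 0 < x] by exact: open_gt.
have cg : Ck_on 1 [set x : R | 0 < x] g.
  have cg0 : Ck_on 0 [set x : R | 0 < x] g.
    by move=> x /dfg; exact: differentiable_continuous.
  split=> [x /dfg //|v].
  apply: (@Ck_on_eq _ _ _ _ _ (fun x => v * (- (2^-1 * (g x * (g x * g x)))))) => //.
    move=> x /= x0; have [_ D] := dg x x0.
    by rewrite (derive_real_dir v (dfg x x0)) D !exprS expr0 mulr1.
  apply: (Ck_on_mul op); first exact: Ck_on_cst.
  apply: (Ck_on_opp op); apply: (Ck_on_mul op); first exact: Ck_on_cst.
  exact: (Ck_on_mul op cg0 (Ck_on_mul op cg0 cg0)).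
apply: (@Ck_on_comp _ _ _ _ _ g (fun p => area_I p * area_III p) Omega_open op _ cg).
  by move=> x Ox; exact: area_mul_gt0.
exact: (Ck_on_mul Omega_open (Ck_on_area_I 1) (Ck_on_area_III 1)).
Qed.

Lemma inv_sqrt_area_sq p : Omega p -> r p ^+ 2 * (area_I p * area_III p) = 1.
Proof.
move=> Op; have AB := area_mul_gt0 Op.
by rewrite /r exprVn sqr_sqrtr ?ltW// mulVf// gt_eqF.
Qed.

(* [conf_c ^ 2 = K + 1] and [conf_d = 1 / conf_c]. *)
Definition conf_c p : R := area_III p * r p.
Definition conf_d p : R := area_I p * r p.
Notation c := conf_c.
Notation d := conf_d.

Lemma conf_cd p : Omega p -> c p * d p = 1.
Proof. by move=> /inv_sqrt_area_sq <-; rewrite /c /d; ring. Qed.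

Lemma conf_c_sq p : Omega p -> c p ^+ 2 = extrinsic_curvature f N p.
Proof.
move=> Op; rewrite extrinsic_curvatureE// /c exprMn.
have A0 := area_I_neq0 Op; have B0 := area_III_neq0 Op.
have -> : r p ^+ 2 = (area_I p * area_III p)^-1.
  apply: (mulIf (mulf_neq0 A0 B0)); rewrite inv_sqrt_area_sq// mulVf//.
  exact: mulf_neq0.
by field; rewrite A0 B0.
Qed.

Lemma Ck_on_conf_c : Ck_on 1 Omega c.
Proof. exact: (Ck_on_mul Omega_open (Ck_on_area_III 1) Ck_on_inv_sqrt_area). Qed.

Lemma Ck_on_conf_d : Ck_on 1 Omega d.
Proof. exact: (Ck_on_mul Omega_open (Ck_on_area_I 1) Ck_on_inv_sqrt_area). Qed.

Lemma pd_conf_d v p : Omega p -> pd v d p = - (d p ^+ 2 * pd v c p).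
Proof.
move=> Op; have := @pd_const R v (fun x => c x * d x) 1 p Op conf_cd.
rewrite (pd_mul v (Ck_on_conf_c.1 p Op) (Ck_on_conf_d.1 p Op)) => /(congr1 ( *%R (d p))).
have := conf_cd Op; move: (pd v c p) (pd v d p) (c p) (d p) => x y k l kl.
rewrite mulr0 mulrDr (mulrA l k) (mulrC l k) kl mul1r => E.
by lra.
Qed.

Definition flux0 p : 'M[R]_2 := c p *: (nu p *m mc_form ey p) - d p *: shape ey p.
Definition flux1 p : 'M[R]_2 := d p *: shape ex p - c p *: (nu p *m mc_form ex p).

Let a00 p : R := - (r p * q (mc_form ey p) (shape ey p)).
Let a01 p : R := r p * q (mc_form ex p) (shape ey p).
Let a11 p : R := - (r p * q (mc_form ex p) (shape ex p)).

Lemma flux0E p : Omega p -> flux0 p = a00 p *: pd ex nu p + a01 p *: pd ey nu p.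
Proof.
move=> Op; rewrite (gauss_map_derive ex p) (gauss_map_derive ey p).
exact: (flux_identity _ (gram_gauss0 (gauss_map_dS2 Op) (tangent_mc_x Op) (tangent_mc_y Op)
  (tangent_shape_x Op) (tangent_shape_y Op) (shape_sym Op))).
Qed.

Lemma flux1E p : Omega p -> flux1 p = a01 p *: pd ex nu p + a11 p *: pd ey nu p.
Proof.
move=> Op; rewrite (gauss_map_derive ex p) (gauss_map_derive ey p).
rewrite addrC.
exact: (flux_identity _ (gram_gauss1 (gauss_map_dS2 Op) (tangent_mc_x Op)
  (tangent_mc_y Op)
  (tangent_shape_x Op) (tangent_shape_y Op) (shape_sym Op))).
Qed.

Lemma energy_densityE F p : Omega p ->
  energy_density (fundII f N) F p =
  half_quadratic (a00 p) (a01 p) (a11 p) (pd ex F p) (pd ey F p).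
Proof.
move=> Op; have [e00 e01 e10 e11] := fundIIE Op; have AB := area_mul_gt0 Op.
have sAB : Num.sqrt (area_I p * area_III p) != 0 by rewrite gt_eqF// sqrtr_gt0.
have dII : \det (fundII f N p) = - Num.sqrt (area_I p * area_III p) ^+ 2.
  by rewrite det_fundII// sqr_sqrtr// ltW.
have sdII : Num.sqrt `|\det (fundII f N p)| = Num.sqrt (area_I p * area_III p).
  by rewrite det_fundII// normrN gtr0_norm.
have h10 : fundII f N p 1 0 = q (mc_form ex p) (shape ey p).
  by rewrite (shape_sym Op); exact: e10.
have [g00 g01 g10 g11] := fundI_pd F p.
have T := energy_trace sAB dII e00 e01 h10 e11 g00 g01 g10 g11.
transitivity (2^-1 * \tr (invmx (fundII f N p) *m fundI F p) *
  Num.sqrt (area_I p * area_III p)); last exact: T.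
exact: (f_equal (fun u => _ * u) sdII).
Qed.

Let Ck_on_nu_mc v : Ck_on 1 Omega (fun p => nu p *m mc_form v p) :=
  Ck_on_mulmx Omega_open (nu_smooth 1) (Ck_on_mc_form 1 v).

Lemma Ck_on_flux0 : Ck_on 1 Omega flux0.
Proof.
exact: (Ck_on_submx Omega_open (Ck_on_scalemx Omega_open Ck_on_conf_c (Ck_on_nu_mc ey))
  (Ck_on_scalemx Omega_open Ck_on_conf_d (Ck_on_shape 1 ey))).
Qed.

Lemma Ck_on_flux1 : Ck_on 1 Omega flux1.
Proof.
exact: (Ck_on_submx Omega_open (Ck_on_scalemx Omega_open Ck_on_conf_d (Ck_on_shape 1 ex))
  (Ck_on_scalemx Omega_open Ck_on_conf_c (Ck_on_nu_mc ex))).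
Qed.

Let Ck_on_coef v w : Ck_on 0 Omega (fun p => r p * q (mc_form v p) (shape w p)) :=
  Ck_on_mul Omega_open (Ck_onW Ck_on_inv_sqrt_area)
    (Ck_on_ads Omega_open (Ck_on_mc_form 0 v) (Ck_on_shape 0 w)).

Let a00_cont : Ck_on 0 Omega a00 := Ck_on_opp Omega_open (@Ck_on_coef ey ey).
Let a01_cont : Ck_on 0 Omega a01 := @Ck_on_coef ex ey.
Let a11_cont : Ck_on 0 Omega a11 := Ck_on_opp Omega_open (@Ck_on_coef ex ex).

Lemma mc_form_derive v w p : Omega p ->
  pd w (mc_form v) p = - (mc_form w p *m mc_form v p) + mbar (f p) *m pd w (pd v f) p.
Proof.
move=> Op; have df := (f_smooth 1).1 p Op.
have dmf := (Ck_on_mbar Omega_open (f_smooth 1)).1 p Op.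
have dfv := (Ck_on_pd v (f_smooth 2)).1 p Op.
rewrite (pd_mulmx w dmf dfv) (pd_mbar w df) (mc_formE w Op) mbarM.
rewrite (mbar_tr0 (mc_form_tr0 w Op)) -mulmxA -/(mc_form v p).
by rewrite mulNmx.
Qed.

(** The factor [d ^ 2] comes from differentiating [d = 1 / c]: each derivative of [c] multiplies
    [nu a], and through [d] also [d ^ 2 s]. *)
Definition pole0 p : 'M[R]_2 := nu p *m mc_form ex p + d p ^+ 2 *: shape ex p.
Definition pole1 p : 'M[R]_2 := nu p *m mc_form ey p + d p ^+ 2 *: shape ey p.
Definition tension_tangent p : 'M[R]_2 :=
  pd ex c p *: pole1 p - pd ey c p *: pole0 p.
Notation E := (tension flux0 flux1).

Lemma tensionE p : Omega p -> exists l : R, E p = l *: nu p + tension_tangent p.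
Proof.
move=> Op; have nS := gauss_map_dS2 Op.
have dnu := (nu_smooth 1).1 p Op.
have dc := Ck_on_conf_c.1 p Op; have dd := Ck_on_conf_d.1 p Op.
have da v := (Ck_on_mc_form 1 v).1 p Op.
have dna v := (Ck_on_nu_mc v).1 p Op.
have ds v := (Ck_on_shape 1 v).1 p Op.
have dcna v := (Ck_on_scalemx Omega_open Ck_on_conf_c (Ck_on_nu_mc v)).1 p Op.
have dds v := (Ck_on_scalemx Omega_open Ck_on_conf_d (Ck_on_shape 1 v)).1 p Op.
have pds v w : pd w (shape v) p = pd w nu p *m mc_form v p + nu p *m pd w (mc_form v) p
    - pd w (pd v nu) p.
  rewrite (pd_sub w (dna v) ((Ck_on_pd v (nu_smooth 2)).1 p Op)).
  by rewrite (pd_mulmx w dnu (da v)).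
pose m := area_form (nu p) (shape ex p) (mc_form ey p) -
  area_form (nu p) (shape ey p) (mc_form ex p).
exists ((d p - c p) * m).
rewrite /tension /flux0 /flux1 (pd_sub ex (dcna ey) (dds ey)) (pd_sub ey (dds ex) (dcna ex)).
rewrite (pd_scalemx ex dc (dna ey)) (pd_scalemx ey dc (dna ex)).
rewrite (pd_scalemx ex dd (ds ey)) (pd_scalemx ey dd (ds ex)).
rewrite (pds ey ex) (pds ex ey) (pd_conf_d ex Op) (pd_conf_d ey Op).
rewrite (pd_mulmx ex dnu (da ey)) (pd_mulmx ey dnu (da ex)).
have -> := pdC ex ey Omega_open (nu_smooth 2) Op.
apply: tension_identity.
apply: (integrability_identity (gauss_map_derive ex p) (gauss_map_derive ey p)
  (mc_form_derive ey ex Op)).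
  rewrite (mc_form_derive ex ey Op).
  exact: (f_equal (fun u => - (mc_form ey p *m mc_form ex p) + mbar (f p) *m u)
    (pdC ex ey Omega_open (f_smooth 2) Op)).
apply: (tangent_mul_sub nS (tangent_shape_x Op) (tangent_mc_y Op)
  (tangent_shape_y Op) (tangent_mc_x Op)).
exact: (etrans (ads_formC _ _) (etrans (esym (shape_sym Op)) (ads_formC _ _))).
Qed.

Lemma tension_tangentP p : Omega p -> tangent (nu p) (tension_tangent p).
Proof.
move=> Op; have T0 : tangent (nu p) (pole0 p).
  exact: (tangentD (tangentJ (tangent_mc_x Op)) (tangentZ _ (tangent_shape_x Op))).
have T1 : tangent (nu p) (pole1 p).
  exact: (tangentD (tangentJ (tangent_mc_y Op)) (tangentZ _ (tangent_shape_y Op))).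
exact: (tangentB (tangentZ _ T1) (tangentZ _ T0)).
Qed.

(** By [area_conjugate] the poles have area [d ^ 4 area_III - area_I], which equals
    [- d ^ 2 (area_III - area_I)] and is nonzero; so they are linearly independent. *)
Lemma tension_tangent_eq0 p : Omega p -> tension_tangent p = 0 ->
  pd ex c p = 0 /\ pd ey c p = 0.
Proof.
move=> Op U0; have nS := gauss_map_dS2 Op.
have T0 : tangent (nu p) (pole0 p).
  exact: (tangentD (tangentJ (tangent_mc_x Op)) (tangentZ _ (tangent_shape_x Op))).
have T1 : tangent (nu p) (pole1 p).
  exact: (tangentD (tangentJ (tangent_mc_y Op)) (tangentZ _ (tangent_shape_y Op))).
have wQ : area_form (nu p) (pole0 p) (pole1 p) != 0.
  rewrite (area_conjugate nS (tangent_mc_x Op) (tangent_mc_y Op)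
    (tangent_shape_x Op) (tangent_shape_y Op) (shape_sym Op)).
  rewrite -/(area_I p) -/(area_III p).
  have := area_gauss_neq0 Op; apply: contra => /eqP E0.
  have := inv_sqrt_area_sq Op; have := area_I_neq0 Op; move: E0; rewrite /d.
  move: (area_I p) (area_III p) (r p) => A B x E0 A0 xAB.
  (* The vanishing area reads [d ^ 4 B = A] with [d = A x]. As [x ^ 2 A B = 1], it forces
     [d ^ 2 = 1], and comparing the two gives [A = B]. *)
  have E1 : A * x ^+ 2 * (x ^+ 2 * (A * B)) * A ^+ 2 = A.
    by rewrite -[RHS]addr0 -E0; ring.
  have E2 : x ^+ 2 * A ^+ 2 = 1.
    by apply: (mulfI A0); rewrite mulr1 -[RHS]E1 xAB; ring.
  have x0 : x ^+ 2 * A != 0.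
    by apply/eqP => xA; have := oner_neq0 R; rewrite -xAB mulrA xA mul0r eqxx.
  rewrite subr_eq0; apply/eqP/(mulfI x0); rewrite -mulrA xAB -E2; ring.
exact: (tangent_independent nS T0 T1 wQ U0).
Qed.

(** * First variation of the Gauss map and test variations *)

Notation mu2 := ((@lebesgue_measure R) \x (@lebesgue_measure R))%E.

Let Ck_on_E : Ck_on 0 Omega E :=
  Ck_on_tension Omega_open Ck_on_flux0 Ck_on_flux1.

(** Both implications reduce to a first-order expansion in [t] of the integral of [<F_t - nu, E>]:
    [I] is zero for a normal tension, and a bump-weighted integral for the test variations. *)
Lemma energy_is_derive C eps F (I B : R) : compact C -> C `<=` Omega -> 0 < eps ->
  dS2_variation Omega nu C eps F ->
  (forall t : R, `|t| <= eps / 2 ->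
    `|\int[mu2]_(p in C) q (F (t, p) - nu p) (E p) - t * I| <= B * t ^+ 2) ->
  is_derive (0 : R) (1 : R) (fun t : R => energy (fundII f N) C (fun p => F (t, p))) (- I).
Proof.
move=> cC CO eps0 Fvar HI.
have [M M0 HM] := first_variation_formula Omega_open nu_smooth a00_cont a01_cont
  a11_cont energy_densityE Ck_on_flux0 Ck_on_flux1 flux0E flux1E cC CO eps0 Fvar.
pose e (t : R) := energy (fundII f N) C (fun p => F (t, p)).
pose S (t : R) := \int[mu2]_(p in C) q (F (t, p) - nu p) (E p).
have e2 : 0 < eps / 2 by rewrite divr_gt0.
have z2 : `|0 : R| <= eps / 2 by rewrite normr0 ltW.
have S0 : S 0 = 0.
  have := HI 0 z2; rewrite expr0n mulr0 mul0r subr0 normr_le0 => /eqP; exact.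
have e0 : e 0 = energy (fundII f N) C nu.
  have := HM 0 z2; rewrite expr0n mulr0 normr_le0 => /eqP.
  rewrite -/(S 0) S0 addr0 => /eqP; rewrite subr_eq0 => /eqP; exact.
apply: (@quadratic_is_derive _ e (- I) (M + B) _ e2) => t /ltW te.
have -> : e t - e 0 - t * - I = (e t - energy (fundII f N) C nu + S t) - (S t - t * I).
  by rewrite e0; move: (e t) (energy _ _ _) (S t) => x y z; ring.
apply: (le_trans (ler_normB _ _)); rewrite mulrDl; apply: lerD; first exact: HM.
exact: HI.
Qed.

Lemma tension_normal_harmonic :
  (forall p, Omega p -> pd ex c p = 0 /\ pd ey c p = 0) ->
  harmonic_map Omega (fundII f N) nu.
Proof.
move=> dc0 C eps F cC CO eps0 Fvar.
have EE p : Omega p -> E p = q (E p) (nu p) *: nu p.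
  move=> Op; have [_ qn] := gauss_map_dS2 Op; have [x y] := dc0 p Op.
  have T0 : tension_tangent p = 0.
    transitivity (0 *: pole1 p - 0 *: pole0 p).
      exact: (f_equal2 (fun u v : R => u *: pole1 p - v *: pole0 p) x y).
    have zero (X Y : 'M[R]_2) : 0 *: X - 0 *: Y = 0 by rewrite !scale0r subrr.
    exact: zero.
  have [l El] := tensionE Op; rewrite T0 addr0 in El.
  have ql : q (E p) (nu p) = l by rewrite El ads_formZl qn mulr1.
  by rewrite ql.
have cl : Ck_on 0 Omega (fun p => q (E p) (nu p)) :=
  Ck_on_ads Omega_open Ck_on_E (nu_smooth 0).
have [L L0 HL] := continuous_bounded_on cC CO cl.
have [K K0 HK] := variation_lipschitz Omega_open cC CO eps0 Fvar.
suff HI (t : R) : `|t| <= eps / 2 ->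
    `|\int[mu2]_(p in C) q (F (t, p) - nu p) (E p) - t * 0| <=
      L * K ^+ 2 * fine (mu2 C) * t ^+ 2.
  by have := energy_is_derive cC CO eps0 Fvar HI; rewrite oppr0.
move=> te; rewrite mulr0 subr0.
have te' : `|t| < eps by rewrite (le_lt_trans te)// gtr_pMr// invf_lt1// ltr1n.
have [F_smooth F_dS2 F0 FC] := Fvar.
have cFt : Ck_on 0 Omega (fun p => F (t, p)).
  by apply: Ck_on_slice2 (F_smooth 0) => p Op; split.
have cqE : Ck_on 0 Omega (fun p => q (F (t, p) - nu p) (E p)) :=
  Ck_on_ads Omega_open (Ck_on_submx Omega_open cFt (nu_smooth 0)) Ck_on_E.
rewrite mulrAC; apply: (Rintegral2_bound cC).
  exact: (continuous_integrable2 Omega_open cC CO cqE).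
move=> p Cp; have Op := CO p Cp.
have [_ qFF] := F_dS2 t p te' Op; have [_ qnn] := gauss_map_dS2 Op.
have qG : q (F (t, p) - nu p) (nu p) = - (2^-1 * q (F (t, p) - nu p) (F (t, p) - nu p)).
  rewrite !ads_formBl !ads_formBr qFF qnn (ads_formC (nu p)).
  by move: (q _ _) => x; lra.
rewrite (EE p Op) ads_formZr qG.
have bG := ads_form_bound (mulr_ge0 K0 (normr_ge0 t)) (mulr_ge0 K0 (normr_ge0 t))
  (HK t p te Cp) (HK t p te Cp).
move: (q (F (t, p) - nu p) (F (t, p) - nu p)) bG => x bG.
move: (q (E p) (nu p)) (HL p Cp) => l lL.
rewrite normrM normrN normrM (ger0_norm (_ : 0 <= 2^-1))// -mulrA.
apply: ler_pM => //.
rewrite mulrC ler_pdivrMr//; apply: (le_trans bG).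
rewrite -[t ^+ 2]real_normK ?num_real//.
by rewrite (_ : _ * 2 = 2 * (K * `|t| * (K * `|t|)))//; ring.
Qed.

Section nilpotent_variation.
Variables (X : 'M[R]_2) (p0 : R * R) (rho : R).
Hypothesis XX : X *m X = 0.
Let psi := plane_bump p0 rho.
Let bracket p : 'M[R]_2 := X *m nu p - nu p *m X.
Let W p : 'M[R]_2 := X *m nu p *m X.
(* Conjugation of [nu] by [1 + t psi X], expanded using [X ^ 2 = 0]. *)
Let F (z : R * (R * R)) : 'M[R]_2 := nu z.2 +
  ((z.1 * psi z.2) *: bracket z.2 - (z.1 * psi z.2) ^+ 2 *: W z.2).

Let Ck_on_bracket n : Ck_on n Omega bracket.
Proof.
exact: (Ck_on_submx Omega_open
  (Ck_on_mulmx Omega_open (Ck_on_cst _ _ X) (nu_smooth n))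
  (Ck_on_mulmx Omega_open (nu_smooth n) (Ck_on_cst _ _ X))).
Qed.

Let Ck_on_W n : Ck_on n Omega W.
Proof.
exact: (Ck_on_mulmx Omega_open
  (Ck_on_mulmx Omega_open (Ck_on_cst _ _ X) (nu_smooth n)) (Ck_on_cst _ _ X)).
Qed.

Lemma nilpotent_variation : 0 < rho -> dS2_variation Omega nu (square p0 rho) 1 F.
Proof.
move=> rho0; split.
- move=> n; set S := [set z : R * (R * R) | _].
  have oS : open S := open_time_domain Omega_open.
  have SO (z : R * (R * R)) : S z -> Omega z.2 by case.
  have cs : Ck_on n S (fun z : R * (R * R) => z.1 * psi z.2).
    apply: (Ck_on_mul oS).
      by apply: Ck_on_linear => z; exact: cvg_fst.
    exact: (@Ck_on_snd _ _ _ _ _ S setT psi (fun _ _ => I) (Ck_on_plane_bump n p0 rho)).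
  apply: (Ck_on_add oS); first exact: (Ck_on_snd SO (nu_smooth n)).
  apply: (Ck_on_submx oS); apply: (Ck_on_scalemx oS) => //.
  + exact: (Ck_on_snd SO (Ck_on_bracket n)).
  + exact: (Ck_on_mul oS cs cs).
  + exact: (Ck_on_snd SO (Ck_on_W n)).
- move=> t p _ Op; exact: (dS2_nilpotent_conj (gauss_map_dS2 Op) _ XX).
- by move=> p Op; rewrite /F/= mul0r expr0n !scale0r subrr addr0.
- move=> t p _ Op nCp; rewrite /F/= /psi (plane_bump_out rho0 nCp).
  by rewrite mulr0 expr0n !scale0r subrr addr0.
Qed.

(** [F_t - nu] is a polynomial of degree two in [t], and so is its integral against the tension. The
    linear coefficient gives the derivative, and the quadratic one, [J], the error. *)
Lemma nilpotent_variation_derive : 0 < rho -> square p0 rho `<=` Omega ->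
  is_derive (0 : R) (1 : R)
    (fun t : R => energy (fundII f N) (square p0 rho) (fun p => F (t, p)))
    (- \int[mu2]_(p in square p0 rho) (psi p * q (bracket p) (E p))).
Proof.
move=> rho0 CO; have cC : compact (square p0 rho) by exact: compact_square.
have cpsi : Ck_on 0 Omega psi := Ck_on_subset (@subsetT _ _) (Ck_on_plane_bump 0 p0 rho).
have c1 : Ck_on 0 Omega (fun p => psi p * q (bracket p) (E p)) :=
  Ck_on_mul Omega_open cpsi (Ck_on_ads Omega_open (Ck_on_bracket 0) Ck_on_E).
have c2 : Ck_on 0 Omega (fun p => psi p * psi p * q (W p) (E p)) :=
  Ck_on_mul Omega_open (Ck_on_mul Omega_open cpsi cpsi)
    (Ck_on_ads Omega_open (Ck_on_W 0) Ck_on_E).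
have i1 := continuous_integrable2 Omega_open cC CO c1.
have i2 := continuous_integrable2 Omega_open cC CO c2.
pose J := \int[mu2]_(p in square p0 rho) (psi p * psi p * q (W p) (E p)).
apply: (@energy_is_derive _ 1 F _ `|J| cC CO ltr01 (nilpotent_variation rho0)).
move=> t _.
have c1t : Ck_on 0 Omega (fun p => t * (psi p * q (bracket p) (E p))) :=
  Ck_on_mul Omega_open (Ck_on_cst _ _ t) c1.
have c2t : Ck_on 0 Omega (fun p => t ^+ 2 * (psi p * psi p * q (W p) (E p))) :=
  Ck_on_mul Omega_open (Ck_on_cst _ _ (t ^+ 2)) c2.
have i1t := continuous_integrable2 Omega_open cC CO c1t.
have i2t := continuous_integrable2 Omega_open cC CO c2t.
have -> : \int[mu2]_(p in square p0 rho) q (F (t, p) - nu p) (E p) =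
    \int[mu2]_(p in square p0 rho) (t * (psi p * q (bracket p) (E p)) -
      t ^+ 2 * (psi p * psi p * q (W p) (E p))).
  apply: eq_Rintegral => p _; rewrite /F/= addrC addKr ads_formBl !ads_formZl.
  by move: (q (bracket p) (E p)) (q (W p) (E p)) => x y; ring.
rewrite (Rintegral2B cC i1t i2t) (Rintegral2Z cC _ i1) (Rintegral2Z cC _ i2).
by rewrite addrAC subrr sub0r normrN normrM mulrC -/J (ger0_norm (sqr_ge0 t)).
Qed.

End nilpotent_variation.

(** Replacing [X] by [- X] changes the sign, so it is enough to exclude a positive value. Such a
    value persists on a square around [p], where the bump-weighted integral is positive, whereas
    harmonicity makes this derivative of the energy zero. *)
Lemma harmonic_tension : harmonic_map Omega (fundII f N) nu ->
  forall X p, X *m X = 0 -> Omega p -> q (X *m nu p - nu p *m X) (E p) = 0.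
Proof.
move=> harm; suff le0 X p : X *m X = 0 -> Omega p ->
    q (X *m nu p - nu p *m X) (E p) <= 0.
  move=> X p XX Op.
  have NXX : - X *m - X = 0 by rewrite mulmxN mulNmx XX !oppr0.
  have bN : - X *m nu p - nu p *m - X = - (X *m nu p - nu p *m X).
    by rewrite mulNmx mulmxN opprB opprK addrC.
  have := le0 (- X) p NXX Op; rewrite bN ads_formNl; move: (le0 X p XX Op).
  by move: (q _ _) => x x1 x2; apply/eqP; rewrite eq_le x1 -oppr_le0.
move=> XX Op; rewrite leNgt; apply/negP => g0.
pose g x := q (X *m nu x - nu x *m X) (E x).
have cg : Ck_on 0 Omega g.
  exact: (Ck_on_ads Omega_open (Ck_on_submx Omega_open
    (Ck_on_mulmx Omega_open (Ck_on_cst _ _ X) (nu_smooth 0))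
    (Ck_on_mulmx Omega_open (nu_smooth 0) (Ck_on_cst _ _ X))) Ck_on_E).
have cgp : g x @[x --> p] --> g p := cg p Op.
have ng : nbhs p [set x | 0 < g x] by exact: (cvgr_gt _ cgp).
have [rho rho0 sq] := nbhs_square (filterI (open_nbhs_nbhs (conj Omega_open Op)) ng).
have CO : square p rho `<=` Omega by move=> x /sq[].
have cC : compact (square p rho) by exact: compact_square.
have [_ D1] := harm _ 1 _ cC CO ltr01 (nilpotent_variation p XX rho0).
have [_ D2] := nilpotent_variation_derive XX rho0 CO.
have cu : Ck_on 0 Omega (fun x => plane_bump p rho x * g x) :=
  Ck_on_mul Omega_open (Ck_on_subset (@subsetT _ _) (Ck_on_plane_bump 0 p rho)) cg.
have pos : 0 < \int[mu2]_(x in square p rho) (plane_bump p rho x * g x).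
  apply: (Rintegral_gt0 Omega_open cC CO cu (square_nbhs p rho0)).
    by move=> x /sq[_ gx]; apply: mulr_ge0; [exact: plane_bump_ge0 | exact: ltW].
  apply: mulr_gt0; [exact: plane_bump_center_gt0 | exact: g0].
have : 0 = - \int[mu2]_(x in square p rho) (plane_bump p rho x * g x).
  exact: (etrans (esym D1) D2).
by move=> /esym/eqP; rewrite oppr_eq0 => /eqP I0; rewrite I0 ltxx in pos.
Qed.

Lemma harmonic_conf : harmonic_map Omega (fundII f N) nu ->
  forall p, Omega p -> pd ex c p = 0 /\ pd ey c p = 0.
Proof.
move=> harm p Op; apply: (tension_tangent_eq0 Op).
have [l El] := tensionE Op.
apply: (nilpotent_commutator_test (gauss_map_dS2 Op) (l := l) (tension_tangentP Op)).
move=> X XX; rewrite -El; exact: harmonic_tension.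
Qed.

Lemma harmonic_iff_const_curvature : connected Omega ->
  harmonic_map Omega (fundII f N) nu <->
  exists k : R, forall p, Omega p -> gaussian_curvature f N p = k.
Proof.
move=> cO; split=> [/harmonic_conf dc0|[k Kk]].
  (* On an empty domain every constant will do. *)
  have [[p0 Op0]|/set0P/negP/negPn/eqP O0] := pselect (Omega !=set0); last first.
    by exists 0 => p; rewrite O0.
  exists (gaussian_curvature f N p0) => p Op.
  rewrite /gaussian_curvature -!conf_c_sq//; congr (_ ^+ 2 - 1).
  apply: (derive0_constant Omega_open cO _ Op Op0) => x v Ox.
  have dc := Ck_on_conf_c.1 x Ox; split => //.
  have [x0 y0] := dc0 x Ox.
  case: v => v1 v2; rewrite deriveE//.
  have -> : (v1, v2) = v1 *: axis R 0 + v2 *: axis R 1.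
    by congr (_, _); rewrite /= /GRing.scale/= ?mulr1 ?mulr0 ?addr0 ?add0r.
  rewrite linearD !linearZ/= -!deriveE//.
  rewrite -[X in v1 *: X]/(partial 0 c x) -[X in v2 *: X]/(partial 1 c x).
  by rewrite pd_ex pd_ey x0 y0 !scaler0 addr0.
apply: tension_normal_harmonic => p Op.
have dc := Ck_on_conf_c.1 p Op.
have cc x : Omega x -> c x * c x = k + 1.
  by move=> Ox; rewrite -expr2 conf_c_sq// -(Kk x Ox) /gaussian_curvature subrK.
have c0 : c p != 0.
  apply/eqP => c0; have := conf_cd Op; rewrite c0 mul0r => /esym/eqP.
  by rewrite oner_eq0.
(* Differentiating [c ^ 2 = k + 1] gives [2 c c' = 0], and [c] has the inverse [d]. *)
have D v : pd v c p = 0.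
  have := @pd_const R v (fun x => c x * c x) (k + 1) p Op cc.
  rewrite (pd_mul v dc dc); move: (pd v c p) (c p) c0 => u w w0 e.
  have : w * u = 0 by lra.
  by move=> /eqP; rewrite mulf_eq0 (negbTE w0) => /eqP.
by split; exact: D.
Qed.

End surface.

Unset Implicit Arguments.

Theorem theorem4p4 (R : realType) (Omega : set (R * R))
    (f N : R * R -> 'M[R]_2)
    (Omega_open : open Omega) (Omega_connected : connected Omega)
    (f_timelike : timelike_immersion Omega f)
    (N_normal : unit_normal Omega f N)
    (K_ext_pos : forall p, Omega p -> 0 < extrinsic_curvature f N p)
    (nu_immersion : immersion_on Omega (gauss_map f N)) :
  harmonic_map Omega (fundII f N) (gauss_map f N) <->
  exists c : R, forall p, Omega p -> gaussian_curvature f N p = c.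
Proof.
exact: (harmonic_iff_const_curvature Omega_open f_timelike N_normal K_ext_pos
  nu_immersion Omega_connected).
Qed.
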